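(* Let $V$ be a finite-dimensional Hilbert space, let $\mathcal L^{(0)},\mathcal L^{(1)},\mathcal L^{(2)}:V\to V$ be linear operators and for $\gamma>0$ define $\mathcal L_\gamma=\mathcal L^{(0)}+\gamma\mathcal L^{(1)}+\gamma^2\mathcal L^{(2)}$. Assume: i) (Spectral property) $\mathcal L^{(2)}$ has no nonzero purely imaginary eigenvalues. ii) (Contractivity property) For some norm $\|\cdot\|_\infty$ on $V$ (with the corresponding operator norm on $\operatorname{End}(V)$ denoted in the same way), at least one of the following two conditions holds: $$\forall\gamma>0,\ \forall s\ge0,\ \ \|e^{s\mathcal L_\gamma}\|_\infty\le1\qquad\text{or}\qquad\forall\gamma>0,\ \forall s\ge0,\ \ \|e^{s\mathcal L_\gamma^*}\|_\infty\le1 .$$ iii) (Centering property) $\mathcal P\mathcal L^{(1)}\mathcal P=0$, where $\mathcal P:=\lim_{t\to\infty}e^{t\mathcal L^{(2)}}$ (a projector, well defined thanks to i) and ii)). Then for any $t>0$, $$\lim_{\gamma\to\infty}e^{t\mathcal L_\gamma}=\mathcal P\,e^{t\mathcal L_\infty}\,\mathcal P,\qquad\text{with}\qquad \mathcal L_\infty=\mathcal P\mathcal L^{(0)}\mathcal P-\mathcal P\mathcal L^{(1)}\big(\mathcal L^{(2)}\big)^{-1}\mathcal L^{(1)}\mathcal P ,$$ where $(\mathcal L^{(2)})^{-1}$ is the pseudo-inverse of $\mathcal L^{(2)}$.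
   Context: $\mathcal L^*$ denotes the adjoint of $\mathcal L$ with respect to the Hilbert inner product of $V$. Products of operators are compositions. The pseudo-inverse is $(\mathcal L^{(2)})^{-1}:=-\int_0^\infty\big(e^{s\mathcal L^{(2)}}-\mathcal P\big)\,ds$; it is zero on $\operatorname{Ker}\mathcal L^{(2)}=\operatorname{Im}\mathcal P$ and equals the inverse of the restriction of $\mathcal L^{(2)}$ on $\operatorname{Ker}\mathcal P$. *)

(* Defs.v *)
From HB Require Import structures.
From mathcomp Require Import all_boot all_order all_algebra.
From mathcomp Require Import complex.
From mathcomp Require Import all_classical all_reals all_analysis.

Set Implicit Arguments.
Unset Strict Implicit.
Unset Printing Implicit Defensive.

Import Order.TTheory GRing.Theory Num.Theory.
Import numFieldNormedType.Exports.

Local Open Scope classical_set_scope.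
Local Open Scope complex_scope.
Local Open Scope ring_scope.

(* A finite-dimensional (complex) Hilbert space is a vector space
   V : vectType R[i] together with a positive definite Hermitian form
   dot : {dot V for conjc}, which is linear in its first argument.
   Completeness is automatic in finite dimension. *)

Section Norms.
Context {R : realType} {V : vectType R[i]}.

Record is_norm (N : V -> R) : Prop := IsNorm {
  is_norm_triangle : forall u v, N (u + v) <= N u + N v;
  is_norm_homog : forall (a : R[i]) v, N (a *: v) = Normc.normc a * N v;
  is_norm_definite : forall v, N v = 0 -> v = 0 }.

(* The set is bounded, hence [sup] is a true supremum, because V is
   finite-dimensional. *)
Definition opnorm (N : V -> R) (A : 'End(V)) : R :=
  sup [set N (A v) | v in [set v | N v <= 1]].

End Norms.

Section Operators.
Context {R : realType} {V : vectType R[i]}.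
Variable dot : {dot V for (@conjc R)}.

Definition hnorm (v : V) : R := Num.sqrt (complex.Re (dot v v)).

Definition is_adjoint (A B : 'End(V)) : Prop :=
  forall u v, dot (B u) v = dot u (A v).

Definition adjoint (A : 'End(V)) : 'End(V) := xget 0 [set B | is_adjoint A B].

(* Convergence in End(V), for the operator norm of the Hilbert norm. *)
Definition op_cvg {T : Type} (F : set_system T) (f : T -> 'End(V))
    (A : 'End(V)) : Prop :=
  opnorm hnorm (f x - A) @[x --> F] --> (0 : R).

(* [xget 0] selects the unique element of the set when there is one; a
   divergent family gets the junk limit 0. *)
Definition op_lim {T : Type} (F : set_system T) (f : T -> 'End(V)) : 'End(V) :=
  xget 0 [set A | op_cvg F f A].

Definition op_pow (A : 'End(V)) (k : nat) : 'End(V) :=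
  iter k (fun B => (A \o B)%VF) \1%VF.

Definition op_exp (A : 'End(V)) : 'End(V) :=
  op_lim \oo (fun n : nat => \sum_(k < n) (k`!%:R : R[i])^-1 *: op_pow A k).

(* S is the integral of f over D: the integral is taken on the matrix
   coefficients s |-> <f(s) u, v>, split into real and imaginary parts. *)
Definition is_op_integral (D : set R) (f : R -> 'End(V)) (S : 'End(V)) : Prop :=
  forall u v : V,
    let re s := complex.Re (dot (f s u) v) in
    let im s := complex.Im (dot (f s u) v) in
    [/\ lebesgue_measure.-integrable D (EFin \o re),
        lebesgue_measure.-integrable D (EFin \o im) &
        dot (S u) v = (\int[lebesgue_measure]_(s in D) re s)%R
                   +i* (\int[lebesgue_measure]_(s in D) im s)%R].

Definition op_integral (D : set R) (f : R -> 'End(V)) : 'End(V) :=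
  xget 0 [set S | is_op_integral D f S].

Definition limit_projector (L2 : 'End(V)) : 'End(V) :=
  op_lim +oo (fun t : R => op_exp (t%:C *: L2)).

Definition pseudo_inverse (L2 : 'End(V)) : 'End(V) :=
  - op_integral `[0, +oo[%classic
      (fun s : R => op_exp (s%:C *: L2) - limit_projector L2).

Definition effective_generator (L0 L1 L2 : 'End(V)) : 'End(V) :=
  let P := limit_projector L2 in
  (P \o (L0 \o P))%VF - (P \o (L1 \o (pseudo_inverse L2 \o (L1 \o P))))%VF.

End Operators.

Definition generator {R : realType} {V : vectType R[i]}
    (L0 L1 L2 : 'End(V)) (g : R) : 'End(V) :=
  L0 + g%:C *: L1 + (g ^+ 2)%:C *: L2.

(* Main.v *)
Require Import Defs.
From HB Require Import structures.
From mathcomp Require Import all_boot all_order all_algebra.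
From mathcomp Require Import complex.
From mathcomp Require Import all_classical all_reals all_analysis.
From mathcomp Require Import measurable_realfun ring lra.

Set Implicit Arguments.
Unset Strict Implicit.
Unset Printing Implicit Defensive.

Import Order.TTheory GRing.Theory Num.Theory.
Import numFieldNormedType.Exports.

Local Open Scope classical_set_scope.
Local Open Scope complex_scope.
Local Open Scope ring_scope.

(** Write |X| for the operator norm of X attached to the Hilbert norm and
    L(g) = L0 + g L1 + g^2 L2. Four ingredients give the limit of
    exp (t L(g)).

    Uniform bound. All norms on a finite-dimensional space are equivalent and
    taking Hilbert adjoints preserves |.|, so either form of contractivity
    gives |exp (s L(g))| <= C for all s >= 0 and g > 0 ([uniform_bound]). Over
    times of order 1 / g^2 only L2 is seen: exp ((s / g^2) L(g)) tends to
    exp (s L2) ([rescaled_exp_cvg]); hence exp (s L2) is bounded by C as well.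

    Spectral splitting. Boundedness forces the eigenvalues of L2 to have
    nonpositive real part and forbids a Jordan block at 0; as the only possible
    eigenvalue on the imaginary axis is 0, L2 is annihilated by X q(X) where
    all the roots of q have negative real part. Then P = q(L2) / q(0) satisfies
    L2 P = P L2 = 0, the range of 1 - P lies in the range of L2, and
    |exp (s L2) - P| decays exponentially ([spectral_splitting]). So P is the
    limit projector, and integrating the derivative of exp (s L2) Q, where
    L2 Q = 1 - P, identifies the pseudo-inverse as a solution of
    L2 Q = 1 - P ([comp_pseudo_inverse]).

    Slow part. The approximate slow subspace is the range of
    K(g) = P + G / g + H / g^2 with G = - Q L1 P and H = - Q (L0 P + L1 G). By
    the centering hypothesis and L2 Q = 1 - P the terms of order g^2, g and 1 of
    L(g) K(g) - K(g) Linf cancel ([corrector_intertwines]), where Linf is the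
    effective generator. Duhamel's inequality and the uniform bound turn this
    into exp (t L(g)) P -> exp (t Linf) P ([slow_part_cvg]).

    Fast part. For t > s / g^2, |exp (t L(g)) (1 - P)| is at most
    C |exp ((s / g^2) L(g)) (1 - P)|, which tends to C |exp (s L2) - P| as g
    grows, and the latter is small for s large ([fast_part_cvg]).

    The analysis of exponentials rests on a single derivative,
    d/ds exp ((t - s) A) K exp (s B) = exp ((t - s) A) (K B - A K) exp (s B)
    ([op_deriv_sandwich]); paired with vectors it is an ordinary real
    derivative, and the mean value theorem gives [duhamel]. *)

(** * Norms on finite-dimensional complex spaces *)

Section NormTheory.
Context {R : realType} {W : vectType R[i]} {N : W -> R}.
Hypothesis HN : is_norm N.

Lemma normc_real (x : R) : Normc.normc x%:C = `|x|.
Proof. by rewrite /= expr0n addr0 sqrtr_sqr. Qed.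

Lemma normc_ge0 (z : R[i]) : 0 <= Normc.normc z.
Proof. by case: z => a b; exact: sqrtr_ge0. Qed.

Lemma normc_le_ReIm (z : R[i]) :
  Normc.normc z <= `|complex.Re z| + `|complex.Im z|.
Proof.
case: z => a b /=; rewrite -[leRHS]ger0_norm ?addr_ge0// -sqrtr_sqr ler_wsqrtr//.
rewrite sqrrD !real_normK ?num_real// -addrA addrCA lerDr.
by rewrite mulrn_wge0// mulr_ge0.
Qed.

Lemma ReIm_le_normc (z : R[i]) :
  `|complex.Re z| <= Normc.normc z /\ `|complex.Im z| <= Normc.normc z.
Proof.
case: z => a b /=; rewrite -!sqrtr_sqr; split; apply: ler_wsqrtr.
  by rewrite lerDl sqr_ge0.
by rewrite lerDr sqr_ge0.
Qed.

Lemma norm0 : N 0 = 0.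
Proof. by rewrite -(scale0r 0) (is_norm_homog HN) Normc.normc0 mul0r. Qed.

Lemma normN v : N (- v) = N v.
Proof.
rewrite -scaleN1r (is_norm_homog HN) /= sqrrN expr1n oppr0 expr0n addr0 sqrtr1.
by rewrite mul1r.
Qed.

Lemma norm_ge0 v : 0 <= N v.
Proof.
have := is_norm_triangle HN v (- v); rewrite subrr norm0 normN.
by rewrite -mulr2n pmulrn_lge0.
Qed.

Lemma normB u v : N (u - v) = N (v - u).
Proof. by rewrite -normN opprB. Qed.

Lemma norm_sum (I : Type) (r : seq I) (P : pred I) (F : I -> W) :
  N (\sum_(i <- r | P i) F i) <= \sum_(i <- r | P i) N (F i).
Proof.
elim/big_rec2: _ => [|i y x _ h]; first by rewrite norm0.
by apply: le_trans (is_norm_triangle HN _ _) _; rewrite lerD2l.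
Qed.

Lemma norm_triangleB u v : `|N u - N v| <= N (u - v).
Proof.
have h a b : N a - N b <= N (a - b).
  by rewrite lerBlDr; apply: le_trans (is_norm_triangle HN _ _); rewrite subrK.
by rewrite ler_norml lerNl opprB (normB u) h -normB h.
Qed.

Let n := \dim {: W}.
Let e := vbasis {: W}.

Lemma coord_expand (w : W) : w = \sum_(i < n) coord e i w *: e`_i.
Proof. by apply: coord_vbasis; rewrite memvf. Qed.

(** The coordinates are taken over the real field, where the unit sphere of the
    coordinate space is known to be compact. *)
Definition real_coords (x : 'rV[R]_(n + n)) : W :=
  \sum_(i < n) (x 0 (lshift n i) +i* x 0 (rshift n i)) *: e`_i.

Lemma real_coordsB x y : real_coords (x - y) = real_coords x - real_coords y.
Proof.
rewrite /real_coords -sumrB; apply: eq_bigr => i _.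
by rewrite -scalerBl !mxE.
Qed.

Lemma norm_real_coords :
  exists2 K, 0 <= K & forall x, N (real_coords x) <= K * `|x|.
Proof.
exists (\sum_(i < n) (N e`_i *+ 2)).
  by apply: sumr_ge0 => i _; rewrite mulrn_wge0 ?norm_ge0.
move=> x; apply: le_trans (norm_sum _ _ _) _.
rewrite mulr_suml; apply: ler_sum => i _.
rewrite (is_norm_homog HN) mulrC -mulr_natr -mulrA ler_wpM2l ?norm_ge0//.
apply: le_trans (normc_le_ReIm _) _ => /=; rewrite mulr_natl mulr2n.
have hx j : `|x 0 j| <= `|x|.
  by rewrite {2}/Num.norm/= mx_normrE; apply: (le_bigmax _ _ (0, j)).
by rewrite lerD.
Qed.

Lemma real_coords_surj (w : W) : exists2 x : 'rV[R]_(n + n),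
  w = real_coords x &
  forall i, Normc.normc (coord e i w) <= `|x| *+ 2.
Proof.
pose f (j : 'I_n + 'I_n) := match j with
  | inl i => complex.Re (coord e i w) | inr i => complex.Im (coord e i w) end.
exists (\row_j f (fintype.split j)).
  rewrite [LHS]coord_expand; apply: eq_bigr => i _; rewrite !mxE.
  rewrite (unsplitK (inl i)) (unsplitK (inr i)) /=.
  by case: (coord e i w).
move=> i; apply: le_trans (normc_le_ReIm _) _ => /=; rewrite mulr2n.
set x := \row_j _.
have hx j : `|x 0 j| <= `|x|.
  by rewrite {2}/Num.norm/= mx_normrE; apply: (le_bigmax _ _ (0, j)).
have := hx (lshift n i); have := hx (rshift n i); rewrite !mxE.
by rewrite (unsplitK (inl i)) (unsplitK (inr i)) /=; lra.
Qed.

Lemma real_coords_inj x : real_coords x = 0 -> x = 0.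
Proof.
move=> x0; have /freeP h : free e by exact: basis_free (vbasisP _).
apply/rowP => j; rewrite !mxE.
have {}h i := h (fun i => x 0 (lshift n i) +i* x 0 (rshift n i)) x0 i.
by rewrite -(splitK j); case: (fintype.split j) => i /=; have [] := h i.
Qed.

Lemma continuous_norm_real_coords : continuous (N \o real_coords).
Proof.
have [K K0 hK] := norm_real_coords.
move=> x; have Fx := nbhs_filter (x : 'rV[R]_(n + n)).
apply/(@cvgrPdist_lt _ _ _ _ Fx) => /= eps e0.
have d0 : 0 < eps / (K + 1) by rewrite divr_gt0// ltr_wpDl.
near=> y.
apply: le_lt_trans (norm_triangleB _ _) _; rewrite -real_coordsB.
apply: le_lt_trans (hK _) _.
have : `|x - y| < eps / (K + 1).
  near: y; apply/(@nbhs_normP R 'rV[R]_(n + n)); exists (eps / (K + 1)) => //.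
rewrite ltr_pdivlMr ?ltr_wpDl// mulrDr mulr1 => h.
by apply: le_lt_trans h; rewrite mulrC lerDl.
Unshelve. all: by end_near. Qed.

(** Every norm dominates the coordinates: composed with the real coordinates
    it is continuous and positive on the compact unit sphere, hence bounded
    away from zero there. *)
Lemma norm_coord_le : exists2 C, 0 < C &
  forall (i : 'I_n) w, Normc.normc (coord e i w) <= C * N w.
Proof.
pose S := [set x : 'rV[R]_(n + n) | `|x| = 1].
suff [m m0 hm] : exists2 m, 0 < m & forall x, m * `|x| <= N (real_coords x).
  exists (2 / m); first by rewrite divr_gt0.
  move=> i w; have [x -> /(_ i) hi] := real_coords_surj w.
  apply: le_trans hi _; rewrite -[leLHS]mulr_natl -mulrA ler_pM2l//.
  by rewrite mulrC ler_pdivlMr// mulrC hm.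
have [S0|S0] := pselect (S !=set0); last first.
  exists 1 => // x; rewrite mul1r.
  have [->|x0] := eqVneq x 0; first by rewrite normr0 norm_ge0.
  exfalso; apply: S0; exists (`|x|^-1 *: x); rewrite /S/= normrZ normfV normr_id.
  by rewrite mulVf// normr_eq0.
have cS : compact S.
  apply: bounded_closed_compact.
    exists 1; split => // M M1 x /=; rewrite /S/= => ->; exact: ltW.
  have -> : S = (fun x : 'rV[R]_(n + n) => `|x|) @^-1` [set 1] by [].
  apply: preimage_closed; last exact: closed_eq.
  move=> x _; exact: (@norm_continuous R 'rV[R]_(n + n)).
have [|c cS1 hc] := EVT_min_rV S0 cS (f := N \o real_coords).
  by apply: continuous_subspaceT; exact: continuous_norm_real_coords.
exists (N (real_coords c)).
  rewrite lt_neqAle norm_ge0 andbT eq_sym; apply/eqP => /(is_norm_definite HN).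
  move/real_coords_inj => c0; move: cS1; rewrite inE /S/= c0 normr0 => /esym/eqP.
  by rewrite oner_eq0.
move=> x; have [->|x0] := eqVneq x 0; first by rewrite normr0 mulr0 norm_ge0.
have nx0 : 0 < `|x| by rewrite normr_gt0.
have /hc : `|x|^-1 *: x \in S.
  by rewrite inE /S/= normrZ normfV normr_id mulVf ?gt_eqF.
move=> /= h; rewrite -ler_pdivlMr//; apply: le_trans h _.
suff -> : real_coords (`|x|^-1 *: x) = (`|x|^-1)%:C *: real_coords x.
  by rewrite (is_norm_homog HN) normc_real mulrC ger0_norm ?invr_ge0.
rewrite /real_coords scaler_sumr; apply: eq_bigr => i _.
by rewrite scalerA !mxE; congr (_ *: _); rewrite /GRing.mul/=; simpc.
Qed.

End NormTheory.

(** * Operator norms *)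

Section OperatorNorm.
Context {R : realType} {V : vectType R[i]}.
Implicit Types (A B : 'End(V)) (N M : V -> R).

(** A vector is controlled by its coordinates, and these by the norm. Boundedness
    is what makes the supremum in the operator norm meaningful. *)
Lemma lfun_bounded N M (HN : is_norm N) (HM : is_norm M) A :
  exists2 c, 0 <= c & forall v, M (A v) <= c * N v.
Proof.
have [C C0 hC] := norm_coord_le HN.
pose e := vbasis {: V}.
exists (\sum_(i < \dim {: V}) C * M (A e`_i)).
  by apply: sumr_ge0 => i _; rewrite mulr_ge0 ?norm_ge0// ltW.
move=> v; rewrite [in leLHS](coord_expand v) linear_sum /=.
apply: le_trans (norm_sum HM _ _ _) _; rewrite mulr_suml.
apply: ler_sum => i _; rewrite linearZ/= (is_norm_homog HM) mulrAC.
by rewrite ler_wpM2r ?norm_ge0// hC.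
Qed.

Section Opnorm.
Context {N : V -> R}.
Hypothesis HN : is_norm N.

Let opnorm_has_sup A : has_sup [set N (A v) | v in [set v | N v <= 1]].
Proof.
split; first by exists (N (A 0)), 0 => //=; rewrite norm0.
have [c c0 hc] := lfun_bounded HN HN A.
exists c => _ [v /= v1 <-]; apply: le_trans (hc v) _.
by rewrite -[leRHS]mulr1 ler_wpM2l.
Qed.

Lemma opnorm_ge0 A : 0 <= opnorm N A.
Proof.
apply: sup_ubound; first by case: (opnorm_has_sup A).
by exists 0; rewrite /= ?linear0 norm0.
Qed.

Lemma opnorm_bound A v : N (A v) <= opnorm N A * N v.
Proof.
have [->|v0] := eqVneq v 0; first by rewrite linear0 norm0// mulr0.
have nv : 0 < N v.
  rewrite lt_neqAle norm_ge0// andbT eq_sym; apply/eqP => /(is_norm_definite HN).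
  exact/eqP.
rewrite -ler_pdivrMr//; apply: sup_ubound; first by case: (opnorm_has_sup A).
exists ((N v)^-1%:C *: v) => /=.
  rewrite (is_norm_homog HN) normc_real ger0_norm ?invr_ge0 ?(ltW nv)//.
  by rewrite mulVf ?gt_eqF.
rewrite linearZ/= (is_norm_homog HN) normc_real mulrC.
by rewrite ger0_norm ?invr_ge0 ?(ltW nv).
Qed.

Lemma opnorm_le A c : 0 <= c -> (forall v, N (A v) <= c * N v) -> opnorm N A <= c.
Proof.
move=> c0 hc; apply: ge_sup; first by case: (opnorm_has_sup A).
move=> _ [v /= v1 <-]; apply: le_trans (hc v) _.
by rewrite -[leRHS]mulr1 ler_wpM2l.
Qed.

Lemma opnorm_is_norm : is_norm (@opnorm R V N).
Proof.
have hom (a : R[i]) A : opnorm N (a *: A) <= Normc.normc a * opnorm N A.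
  apply: opnorm_le => [|v]; first by rewrite mulr_ge0 ?opnorm_ge0 ?normc_ge0.
  rewrite lfunE/= (is_norm_homog HN) -mulrA ler_wpM2l ?normc_ge0//.
  exact: opnorm_bound.
have id0 A : opnorm N A = 0 -> A = 0.
  move=> A0; apply/lfunP => v; rewrite lfunE; apply: (is_norm_definite HN).
  by apply/eqP; rewrite eq_le norm_ge0// andbT -(mul0r (N v)) -A0 opnorm_bound.
split=> // [A B|a A].
  apply: opnorm_le => [|v]; first by rewrite addr_ge0 ?opnorm_ge0.
  rewrite lfunE/= mulrDl; apply: le_trans (is_norm_triangle HN _ _) _.
  by rewrite lerD ?opnorm_bound.
apply/eqP; rewrite eq_le hom/=.
have [->|a0] := eqVneq a 0; first by rewrite Normc.normc0 mul0r opnorm_ge0.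
have := hom a^-1 (a *: A); rewrite scalerA mulVf// scale1r Normc.normcV.
rewrite ler_pdivlMl// lt_neqAle normc_ge0 andbT eq_sym.
by apply: contra_neq a0 => /Normc.eq0_normc.
Qed.

Lemma opnorm_comp A B : opnorm N (A \o B)%VF <= opnorm N A * opnorm N B.
Proof.
apply: opnorm_le => [|v]; first by rewrite mulr_ge0 ?opnorm_ge0.
rewrite lfunE/= -mulrA; apply: le_trans (opnorm_bound _ _) _.
by rewrite ler_wpM2l ?opnorm_ge0 ?opnorm_bound.
Qed.

Lemma opnorm_id : opnorm N \1%VF <= 1.
Proof. by apply: opnorm_le => // v; rewrite lfunE mul1r. Qed.

End Opnorm.

(** The equivalence of N and M, used once before and once after A. *)
Lemma opnorm_equiv N M (HN : is_norm N) (HM : is_norm M) :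
  exists2 c, 0 <= c & forall A, opnorm M A <= c * opnorm N A.
Proof.
have [a a0 ha] := lfun_bounded HN HM \1%VF.
have [b b0 hb] := lfun_bounded HM HN \1%VF.
exists (a * b); first by rewrite mulr_ge0.
move=> A; apply: opnorm_le => // [|v].
  by rewrite !mulr_ge0 ?(opnorm_ge0 HN).
have := ha (A v); rewrite lfunE/= => /le_trans; apply.
apply: (@le_trans _ _ (a * (opnorm N A * (b * M v)))); last first.
  by rewrite le_eqVlt; apply/orP; left; apply/eqP; ring.
rewrite ler_wpM2l//; apply: le_trans (opnorm_bound HN _ _) _.
by rewrite ler_wpM2l ?opnorm_ge0//; have := hb v; rewrite lfunE.
Qed.

End OperatorNorm.

(** * The real inner product of a Hilbert space *)

Section HilbertNorm.
Context {R : realType} {V : vectType R[i]}.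
Variable dot : {dot V for (@conjc R)}.
Implicit Types (u v w : V) (a : R[i]).

Lemma dotC u v : dot v u = (dot u v)^*%C.
Proof. by rewrite (hermC dot) expr0 mul1r. Qed.

Lemma dotZl a u v : dot (a *: u) v = a * dot u v.
Proof. by rewrite linearZl_LR. Qed.

Lemma dotZr a u v : dot u (a *: v) = a^*%C * dot u v.
Proof. by rewrite linearZr_LR. Qed.

(** Working with the real part keeps all the estimates in the real field; the
    imaginary part is recovered by [dot_rip]. *)
Definition rip u v : R := complex.Re (dot u v).

Lemma ripC u v : rip u v = rip v u.
Proof. by rewrite /rip (dotC v u); case: (dot v u). Qed.

Lemma ReD (x y : R[i]) : complex.Re (x + y) = complex.Re x + complex.Re y.
Proof. by case: x; case: y. Qed.

Lemma ripDl u v w : rip (u + v) w = rip u w + rip v w.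
Proof. by rewrite /rip linearDl ReD. Qed.

Lemma ripDr u v w : rip w (u + v) = rip w u + rip w v.
Proof. by rewrite !(ripC w) ripDl. Qed.

Lemma ripZl (a : R) u w : rip (a%:C *: u) w = a * rip u w.
Proof. by rewrite /rip dotZl; case: (dot u w) => c d /=; rewrite mul0r subr0. Qed.

Lemma ripZr (a : R) u w : rip u (a%:C *: w) = a * rip u w.
Proof. by rewrite ripC ripZl ripC. Qed.

Lemma ripNl u w : rip (- u) w = - rip u w.
Proof. by rewrite -(scaleN1r u) -[-1](rmorphN1 (real_complex R)) ripZl mulN1r. Qed.

Lemma ripBl u v w : rip (u - v) w = rip u w - rip v w.
Proof. by rewrite ripDl ripNl. Qed.

Lemma ripBr u v w : rip w (u - v) = rip w u - rip w v.
Proof. by rewrite !(ripC w) ripBl. Qed.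

Lemma rip0 u : rip 0 u = 0.
Proof. by rewrite -(subrr u) ripBl subrr. Qed.

Lemma dot_rip u v : dot u v = rip u v +i* rip u ('i *: v).
Proof.
rewrite /rip dotZr; case: (dot u v) => a b.
by rewrite /GRing.mul/= mul0r mulN1r opprK add0r.
Qed.

Lemma dot_self v : dot v v = (rip v v)%:C.
Proof.
have := dotC v v; rewrite /rip; case: (dot v v) => a b [] /eqP.
by rewrite -addr_eq0 -mulr2n mulrn_eq0/= => /eqP ->.
Qed.

Lemma rip_gt0 v : v != 0 -> 0 < rip v v.
Proof. by move=> /(neq0_dnorm_gt0 (s := dot)); rewrite dot_self ltcR. Qed.

Lemma rip_ge0 v : 0 <= rip v v.
Proof. by have [->|/rip_gt0/ltW//] := eqVneq v 0; rewrite rip0. Qed.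

Lemma rip_inj u v : (forall w, rip u w = rip v w) -> u = v.
Proof.
move=> h; apply/eqP; rewrite -subr_eq0; apply: contraT => /rip_gt0.
by rewrite ripBl h subrr ltxx.
Qed.

Lemma hnormE v : hnorm dot v = Num.sqrt (rip v v).
Proof. by []. Qed.

Lemma hnorm_ge0 v : 0 <= hnorm dot v.
Proof. exact: sqrtr_ge0. Qed.

Lemma hnorm_sqr v : hnorm dot v ^+ 2 = rip v v.
Proof. by rewrite sqr_sqrtr// rip_ge0. Qed.

Lemma rip_cauchy u v : `|rip u v| <= hnorm dot u * hnorm dot v.
Proof.
rewrite -(ler_pXn2r (n := 2)) ?nnegrE ?mulr_ge0 ?hnorm_ge0//.
rewrite real_normK ?num_real// exprMn !hnorm_sqr.
have [->|v0] := eqVneq v 0; first by rewrite ripC !rip0 mulr0 expr0n.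
have vv := rip_gt0 v0; have := rip_ge0 ((rip v v)%:C *: u - (rip u v)%:C *: v).
rewrite !(ripBl, ripBr, ripZl, ripZr) (ripC v u).
rewrite (_ : _ - _ = rip v v * (rip u u * rip v v - rip u v ^+ 2)); last by ring.
by rewrite pmulr_rge0// subr_ge0.
Qed.

Lemma hnorm_is_norm : is_norm (hnorm dot).
Proof.
split=> [u v|a v|v].
- rewrite -(ler_pXn2r (n := 2)) ?nnegrE ?addr_ge0 ?hnorm_ge0//.
  rewrite sqrrD !hnorm_sqr !(ripDl, ripDr) (ripC v u).
  have /(le_trans (ler_norm _)) h := rip_cauchy u v.
  by rewrite mulr2n; lra.
- rewrite !hnormE /rip dotZl dotZr dot_self; case: a => a b /=.
  rewrite -sqrtrM ?addr_ge0 ?sqr_ge0//; congr Num.sqrt.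
  by ring.
- move=> v0; apply/eqP; apply: contra_eqT v0 => /rip_gt0 vv.
  by rewrite hnormE sqrtr_eq0 -ltNge.
Qed.

End HilbertNorm.

(** * Absolutely convergent series *)

Section CvgZero.
Context {R : realType} {T : Type} {F : set_system T} {FF : Filter F}.
Implicit Types f g : T -> R.

Lemma cvg0D f g : f x @[x --> F] --> (0 : R) -> g x @[x --> F] --> (0 : R) ->
  f x + g x @[x --> F] --> (0 : R).
Proof. by move=> f0 g0; have := cvgD f0 g0; rewrite addr0; exact. Qed.

Lemma cvg0Ml (c : R) f : f x @[x --> F] --> (0 : R) ->
  c * f x @[x --> F] --> (0 : R).
Proof. by move=> f0; have := cvgMl_tmp (a := c) f0; rewrite mulr0; exact. Qed.

Lemma cvg0Mr (c : R) f : f x @[x --> F] --> (0 : R) ->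
  f x * c @[x --> F] --> (0 : R).
Proof. by move=> f0; have := cvgMr_tmp (b := c) f0; rewrite mul0r; exact. Qed.

Lemma cvg0_sum (I : Type) (r : seq I) (f : I -> T -> R) :
  (forall i, f i x @[x --> F] --> (0 : R)) ->
  \sum_(i <- r) f i x @[x --> F] --> (0 : R).
Proof.
move=> h; elim: r => [|i r IH].
  rewrite (_ : (fun x => _) = fun=> 0); last first.
    by apply/funext => x; rewrite big_nil.
  exact: cvg_cst.
rewrite (_ : (fun x => _) = fun x => f i x + (\sum_(i <- r) f i x)); last first.
  by apply/funext => x; rewrite big_cons.
exact: cvg0D.
Qed.

End CvgZero.

Section AbsolutelyConvergent.
Context {R : realType} {W : vectType R[i]} {N : W -> R}.
Hypothesis HN : is_norm N.

(** Finite-dimensional spaces are complete: an absolutely convergent series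
    converges coordinate by coordinate. *)
Lemma abs_series_cvg (u : nat -> W) (a : R ^nat) :
  (forall k, N (u k) <= a k) -> cvgn (series a) ->
  exists S, N (\sum_(k < n) u k - S) @[n --> \oo] --> (0 : R).
Proof.
move=> ua ca; have [C C0 hC] := norm_coord_le HN.
set e := vbasis {: W} in hC.
have a0 k : 0 <= a k by apply: le_trans (ua k); exact: norm_ge0.
have abs_cvg (g : W -> R) : (forall w, `|g w| <= C * N w) ->
    cvgn (series (fun k => g (u k))).
  move=> hg; apply: normed_cvg.
  apply: (@series_le_cvg _ _ (fun k => C * a k)) => [k|k|k|] //=.
  - by rewrite mulr_ge0 // ltW.
  - by apply: le_trans (hg _) _; rewrite ler_pM2l.
  - exact: is_cvg_seriesZ.
pose re i k := complex.Re (coord e i (u k)).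
pose im i k := complex.Im (coord e i (u k)).
have cre i : cvgn (series (re i)).
  apply: (abs_cvg (fun w => complex.Re (coord e i w))) => w.
  by apply: le_trans (hC i w); have [] := ReIm_le_normc (coord e i w).
have cim i : cvgn (series (im i)).
  apply: (abs_cvg (fun w => complex.Im (coord e i w))) => w.
  by apply: le_trans (hC i w); have [] := ReIm_le_normc (coord e i w).
exists (\sum_(i < \dim {: W})
          (limn (series (re i)) +i* limn (series (im i))) *: e`_i).
pose F n := \sum_(i < \dim {: W})
  (`|series (re i) n - limn (series (re i))|
    + `|series (im i) n - limn (series (im i))|) * N e`_i.
apply: (@squeeze_cvgr _ _ _ _ (fun=> 0) F).
- near=> n; rewrite norm_ge0//=.
  rewrite [X in X - _](coord_expand) -sumrB; apply: le_trans (norm_sum HN _ _ _) _.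
  apply: ler_sum => i _; rewrite -scalerBl (is_norm_homog HN).
  rewrite ler_wpM2r ?norm_ge0//; apply: le_trans (normc_le_ReIm _) _.
  rewrite linear_sum/= !seriesEord/= /re /im.
  have -> : \sum_(k < n) coord e i (u k) =
      (\sum_(k < n) complex.Re (coord e i (u k)))
        +i* (\sum_(k < n) complex.Im (coord e i (u k))).
    elim/big_rec3: _ => // k x y z _ ->.
    by case: (coord e i (u k)) => c d.
  by [].
- exact: cvg_cst.
- apply: cvg0_sum => i; apply: cvg0Mr; apply: cvg0D.
    by apply/norm_cvg0P; apply/subr_cvg0; exact: cre.
  by apply/norm_cvg0P; apply/subr_cvg0; exact: cim.
Unshelve. all: by end_near. Qed.

End AbsolutelyConvergent.

(** * Limits of operators and the exponential series *)

Section OperatorLimits.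
Context {R : realType} {V : vectType R[i]}.
Variable dot : {dot V for (@conjc R)}.
Implicit Types (A B X Y : 'End(V)).
Local Notation opn := (opnorm (hnorm dot)).
Let HN := hnorm_is_norm dot.
Let HE := opnorm_is_norm HN.

Section Filters.
Context {T : Type} {F : set_system T} {FF : ProperFilter F}.
Implicit Types f g : T -> 'End(V).

Lemma op_cvg_le f X (b : T -> R) :
  (\forall x \near F, opn (f x - X) <= b x) ->
  b x @[x --> F] --> (0 : R) -> op_cvg dot F f X.
Proof.
move=> fb b0; apply: (@squeeze_cvgr _ _ _ _ (fun=> 0) b) => //.
  by apply: filterS fb => x ->; rewrite norm_ge0.
exact: cvg_cst.
Qed.

Lemma op_cvg_norm_le f X c : op_cvg dot F f X ->
  (\forall x \near F, opn (f x) <= c) -> opn X <= c.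
Proof.
move=> fX fc; rewrite -subr_le0; apply: (cvgr_to_ge fX).
apply: filterS fc => x xc; rewrite lerBlDr (normB HE).
apply: le_trans (lerD (lexx _) xc).
by rewrite -[in leLHS](subrK (f x) X); exact: is_norm_triangle.
Qed.

Lemma op_cvgD f g X Y : op_cvg dot F f X -> op_cvg dot F g Y ->
  op_cvg dot F (fun x => f x + g x) (X + Y).
Proof.
move=> fX gY; apply: (op_cvg_le (b := fun x => opn (f x - X) + opn (g x - Y))).
  apply: nearW => x; rewrite opprD addrACA; exact: is_norm_triangle.
exact: cvg0D.
Qed.

Lemma op_cvgZ f X a : op_cvg dot F f X ->
  op_cvg dot F (fun x => a *: f x) (a *: X).
Proof.
move=> fX; apply: (op_cvg_le (b := fun x => Normc.normc a * opn (f x - X))).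
  by apply: nearW => x; rewrite -scalerBr (is_norm_homog HE).
exact: cvg0Ml.
Qed.

Lemma op_cvgB f g X Y : op_cvg dot F f X -> op_cvg dot F g Y ->
  op_cvg dot F (fun x => f x - g x) (X - Y).
Proof.
move=> fX gY; apply: (op_cvg_le (b := fun x => opn (f x - X) + opn (g x - Y))).
  apply: nearW => x; rewrite opprD addrACA -opprD.
  by apply: le_trans (is_norm_triangle HE _ _) _; rewrite (normN HE).
exact: cvg0D.
Qed.

Lemma op_cvg_compl f A X : op_cvg dot F f X ->
  op_cvg dot F (fun x => (A \o f x)%VF) (A \o X)%VF.
Proof.
move=> fX; apply: (op_cvg_le (b := fun x => opn A * opn (f x - X))).
  apply: nearW => x; rewrite -comp_lfunNr -comp_lfunDr; exact: opnorm_comp.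
exact: cvg0Ml.
Qed.

Lemma op_cvg_compr f A X : op_cvg dot F f X ->
  op_cvg dot F (fun x => (f x \o A)%VF) (X \o A)%VF.
Proof.
move=> fX; apply: (op_cvg_le (b := fun x => opn (f x - X) * opn A)).
  apply: nearW => x; rewrite -comp_lfunNl -comp_lfunDl; exact: opnorm_comp.
exact: cvg0Mr.
Qed.

Lemma op_cvg_cst X : op_cvg dot F (fun=> X) X.
Proof.
apply: (op_cvg_le (b := fun=> 0)); last exact: cvg_cst.
by apply: nearW => x; rewrite subrr norm0.
Qed.

Lemma op_cvg_unique f X Y : op_cvg dot F f X -> op_cvg dot F f Y -> X = Y.
Proof.
move=> fX fY; apply/eqP; rewrite -subr_eq0; apply/eqP/(is_norm_definite HE).
apply/eqP; rewrite eq_le norm_ge0// andbT.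
apply: (op_cvg_norm_le (op_cvgB fX fY)); apply: nearW => x.
by rewrite subrr norm0.
Qed.

Lemma op_limE f X : op_cvg dot F f X -> op_lim dot F f = X.
Proof. by move=> fX; apply: xget_unique => // Y /op_cvg_unique; exact. Qed.

End Filters.

Lemma op_powZ a A k : op_pow (a *: A) k = a ^+ k *: op_pow A k.
Proof.
elim: k => [|k IH]; first by rewrite expr0 scale1r.
rewrite /op_pow/= -/(op_pow _ k) IH -comp_lfunZl -comp_lfunZr scalerA.
by rewrite exprS.
Qed.

Lemma op_powSr A k : op_pow A k.+1 = (op_pow A k \o A)%VF.
Proof.
elim: k => [|k IH]; first by rewrite /= comp_lfun1l comp_lfun1r.
transitivity (A \o op_pow A k.+1)%VF; first by [].
by rewrite {1}IH comp_lfunA.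
Qed.

Lemma op_pow_norm A k : opn (op_pow A k) <= opn A ^+ k.
Proof.
elim: k => [|k IH]; first by rewrite expr0; exact: opnorm_id.
rewrite exprS; apply: le_trans (opnorm_comp HN _ _) _.
by rewrite ler_wpM2l ?opnorm_ge0.
Qed.

Lemma opnZ (s : R) A : opn (s%:C *: A) = `|s| * opn A.
Proof. by rewrite (is_norm_homog HE) normc_real. Qed.

Lemma inv_natC (k : nat) : (k%:R : R[i])^-1 = (k%:R^-1)%:C.
Proof. by rewrite fmorphV rmorph_nat. Qed.

Definition exp_sum A n : 'End(V) := \sum_(k < n) (k`!%:R : R[i])^-1 *: op_pow A k.

(** With real coefficients the partial sums are compared termwise with those of
    the real exponential. *)
Lemma exp_sumZ (s : R) A n :
  exp_sum (s%:C *: A) n = \sum_(k < n) (exp_coeff s k)%:C *: op_pow A k.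
Proof.
apply: eq_bigr => k _; rewrite op_powZ scalerA; congr (_ *: _).
by rewrite inv_natC -rmorphXn -rmorphM mulrC.
Qed.

Lemma exp_coeff_sum_le (x : R) n : 0 <= x ->
  \sum_(k < n) exp_coeff x k <= expR x.
Proof.
move=> x0; have := @nondecreasing_cvgn_le R (series (exp_coeff x)).
rewrite /expR seriesEord; apply; last first.
  by rewrite -seriesEord; exact: is_cvg_series_exp_coeff.
move=> p q pq /=; rewrite -!(big_mkord xpredT (exp_coeff x)).
rewrite (big_cat_nat (n := p) (p := q))//= lerDl sumr_ge0// => k _.
by rewrite /exp_coeff/= divr_ge0 ?exprn_ge0.
Qed.

Lemma op_exp_cvg A : op_cvg dot \oo (exp_sum A) (op_exp dot A).
Proof.
have [|S hS] := abs_series_cvg (HE)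
    (u := fun k => (k`!%:R : R[i])^-1 *: op_pow A k) _
    (@is_cvg_series_exp_coeff R (opn A)).
  move=> k; rewrite inv_natC opnZ ger0_norm ?invr_ge0// mulrC.
  by rewrite ler_wpM2r ?invr_ge0 ?op_pow_norm.
by rewrite /op_exp (@op_limE _ _ _ _ S).
Qed.

Lemma op_expE A S : op_cvg dot \oo (exp_sum A) S -> op_exp dot A = S.
Proof. exact: op_limE. Qed.

Lemma op_exp_norm A : opn (op_exp dot A) <= expR (opn A).
Proof.
apply: (op_cvg_norm_le (op_exp_cvg A)); apply: nearW => n.
apply: le_trans (exp_coeff_sum_le _ (opnorm_ge0 HN _)).
apply: le_trans (norm_sum HE _ _ _) _; apply: ler_sum => k _.
rewrite inv_natC opnZ ger0_norm ?invr_ge0// mulrC.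
by rewrite ler_wpM2r ?invr_ge0 ?op_pow_norm.
Qed.

Lemma op_cvg_shift (f : nat -> 'End(V)) X N : op_cvg dot \oo f X ->
  op_cvg dot \oo (fun n => f (n + N)%N) X.
Proof. by move=> h; rewrite /op_cvg (cvg_shiftn N (fun n => opn (f n - X))). Qed.

Lemma op_exp0 : op_exp dot 0 = \1%VF.
Proof.
apply: (op_cvg_unique (op_cvg_shift 1 (op_exp_cvg 0))).
rewrite (_ : (fun n => _) = fun=> \1%VF); first exact: op_cvg_cst.
apply/funext => n; rewrite addn1 /exp_sum big_ord_recl big1 ?addr0/=.
  by rewrite invr1 scale1r.
by move=> i _; rewrite /bump/= add1n comp_lfun0l scaler0.
Qed.

End OperatorLimits.

(** * Derivatives with quadratic remainder *)

Section Derivatives.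
Context {R : realType}.

Lemma is_derive_quadratic (f : R -> R) (s d C : R) :
  (forall h, `|h| <= 1 -> `|f (s + h) - f s - h * d| <= C * h ^+ 2) ->
  is_derive s (1 : R) f d.
Proof.
move=> hC.
have C0 : 0 <= C.
  have := hC 1; rewrite normr1 lexx => /(_ isT).
  by rewrite expr1n mulr1; apply: le_trans.
have cf : h^-1 *: ((f \o shift s) (h *: (1 : R)) - f s) @[h --> (0 : R)^'] --> d.
  apply/cvgrPdist_le => /= eps e0; near=> h.
  have h0 : h != 0 by near: h; exact: nbhs_dnbhs_neq.
  have h1 : `|h| <= 1.
    near: h; apply: dnbhs0_le; exact: ltr01.
  have h2 : `|h| <= eps / (C + 1).
    near: h; apply: dnbhs0_le; by rewrite divr_gt0// ltr_wpDl.
  have -> : d - h^-1 *: (f (h *: 1 + s) - f s) =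
      - (h^-1 * (f (s + h) - f s - h * d)).
    rewrite /GRing.scale/= mulr1 (addrC h s); field => //.
  rewrite normrN normrM normfV ler_pdivrMl ?normr_gt0//.
  apply: le_trans (hC _ h1) _; rewrite -real_normK ?num_real// expr2 mulrCA.
  rewrite ler_wpM2l//; move: h2; rewrite ler_pdivlMr ?ltr_wpDl//; apply: le_trans.
  by rewrite mulrC ler_wpM2l// lerDl.
by apply: DeriveDef; [exact: cvgP cf|exact: cvg_lim cf].
Unshelve. all: by end_near. Qed.

(** Induction on k through
    D(k+1) = (s + h) D(k) + h^2 (k+2) s^(k+1), where D is the remainder. *)
Lemma power_taylor (s h M : R) k : `|s| + `|h| <= M ->
  `|(s + h) ^+ k.+2 - s ^+ k.+2 - h * k.+2%:R * s ^+ k.+1|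
    <= h ^+ 2 * (k.+2%:R * k.+1%:R) * M ^+ k.
Proof.
move=> hM; have M0 : 0 <= M by apply: le_trans hM; rewrite addr_ge0.
have sM : `|s| <= M by apply: le_trans hM; rewrite lerDl.
elim: k => [|k IH].
  rewrite (_ : _ - _ - _ = h ^+ 2); last by ring.
  rewrite ger0_norm ?sqr_ge0// expr0 !mulr1.
  by rewrite ler_peMr ?sqr_ge0// ler1n.
have -> : (s + h) ^+ k.+3 - s ^+ k.+3 - h * k.+3%:R * s ^+ k.+2 =
  (s + h) * ((s + h) ^+ k.+2 - s ^+ k.+2 - h * k.+2%:R * s ^+ k.+1)
  + h ^+ 2 * (k.+2%:R * s ^+ k.+1).
  rewrite (exprS _ k.+2) (exprS s k.+2) (exprS s k.+1) -(natr1 k.+2); ring.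
apply: le_trans (ler_normD _ _) _.
rewrite [`|(s + h) * _|]normrM [`|h ^+ 2 * _|]normrM [`|_%:R * _|]normrM.
rewrite (ger0_norm (sqr_ge0 h)) normr_nat normrX.
apply: (@le_trans _ _ (M * (h ^+ 2 * (k.+2%:R * k.+1%:R) * M ^+ k)
    + h ^+ 2 * (k.+2%:R * M ^+ k.+1))).
  apply: lerD; first by rewrite ler_pM// (le_trans (ler_normD _ _)).
  by rewrite ler_wpM2l ?sqr_ge0// ler_wpM2l// lerXn2r ?nnegrE.
rewrite [leLHS](_ : _ = h ^+ 2 * (k.+2%:R * (k.+1%:R + 1)) * M ^+ k.+1); last first.
  by rewrite (exprS M); ring.
rewrite ler_wpM2r ?exprn_ge0// ler_wpM2l ?sqr_ge0// natr1 mulrC ler_wpM2r//.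
by rewrite ler_nat.
Qed.

Lemma exp_coeff_taylor (s h M : R) k : `|s| + `|h| <= M ->
  `|exp_coeff (s + h) k.+2 - exp_coeff s k.+2 - h * exp_coeff s k.+1|
    <= h ^+ 2 * exp_coeff M k.
Proof.
move=> hM; rewrite /exp_coeff/=.
have f0 j : (j`!%:R : R) != 0 by rewrite pnatr_eq0 -lt0n fact_gt0.
have -> : (s + h) ^+ k.+2 / k.+2`!%:R - s ^+ k.+2 / k.+2`!%:R -
   h * (s ^+ k.+1 / k.+1`!%:R) =
   ((s + h) ^+ k.+2 - s ^+ k.+2 - h * k.+2%:R * s ^+ k.+1) / k.+2`!%:R.
  rewrite (factS k.+1) natrM; field.
  by rewrite f0/= -(natrD _ 2 k) pnatr_eq0.
rewrite normrM normfV normr_nat ler_pdivrMr ?ltr0n ?fact_gt0//.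
apply: le_trans (power_taylor k hM) _.
rewrite [leRHS](_ : _ = h ^+ 2 * (k.+2%:R * k.+1%:R) * M ^+ k)//.
rewrite !factS !natrM; field.
exact: f0.
Qed.

End Derivatives.

Section OperatorDerivative.
Context {R : realType} {V : vectType R[i]}.
Variable dot : {dot V for (@conjc R)}.
Implicit Types (A B K X Y : 'End(V)) (f g : R -> 'End(V)) (s t h : R).
Local Notation opn := (opnorm (hnorm dot)).
Let HN := hnorm_is_norm dot.
Let HE := opnorm_is_norm HN.

(** A remainder of order h ^ 2 is more than differentiability asks for, but it
    is available for exponentials and makes the product rule a plain estimate. *)
Definition op_deriv f s X : Prop := exists2 C, 0 <= C &
  forall h, `|h| <= 1 -> opn (f (s + h) - f s - h%:C *: X) <= C * h ^+ 2.

Lemma op_deriv_rip f s X u v : op_deriv f s X ->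
  is_derive s (1 : R) (fun x => rip dot (f x u) v) (rip dot (X u) v).
Proof.
move=> [C C0 hC].
apply: (@is_derive_quadratic _ _ _ _ (C * hnorm dot u * hnorm dot v)) => h h1.
have -> : rip dot (f (s + h) u) v - rip dot (f s u) v - h * rip dot (X u) v =
    rip dot ((f (s + h) - f s - h%:C *: X) u) v.
  by rewrite !add_lfunE !opp_lfunE scale_lfunE !ripBl ripZl.
apply: le_trans (rip_cauchy _ _ _) _.
rewrite [leRHS]mulrAC ler_wpM2r ?hnorm_ge0//.
apply: le_trans (opnorm_bound HN _ _) _.
by rewrite [leRHS]mulrAC ler_wpM2r ?hnorm_ge0// hC.
Qed.

Lemma op_deriv_cst K s : op_deriv (fun=> K) s 0.
Proof.
exists 0 => // h _; rewrite subrr scaler0 subr0 (norm0 HE).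
by rewrite mul0r.
Qed.

Lemma op_deriv_reflect f t s X : op_deriv f (t - s) X ->
  op_deriv (fun x => f (t - x)) s (- X).
Proof.
move=> [C C0 hC]; exists C => // h h1.
have := hC (- h); rewrite normrN => /(_ h1).
by rewrite sqrrN rmorphN scaleNr scalerN opprD addrA.
Qed.

Lemma op_deriv_le f s X : op_deriv f s X -> exists2 c, 0 <= c &
  forall h, `|h| <= 1 -> opn (f (s + h) - f s) <= c * `|h|.
Proof.
move=> [C C0 hC]; exists (C + opn X); first by rewrite addr_ge0 ?opnorm_ge0.
move=> h h1; rewrite -[f (s + h) - f s](subrK (h%:C *: X)).
apply: le_trans (is_norm_triangle HE _ _) _; rewrite mulrDl.
apply: lerD; last by rewrite opnZ mulrC.
apply: le_trans (hC _ h1) _; rewrite ler_wpM2l// -real_normK ?num_real//.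
by rewrite expr2 ler_piMl.
Qed.

Lemma comp_remainder (F G A B X Y : 'End(V)) (c : R[i]) :
  ((F \o G) - (A \o B) - c *: ((X \o B) + (A \o Y)))%VF =
  (((F - A - c *: X) \o B) + (A \o (G - B - c *: Y)) + ((F - A) \o (G - B)))%VF.
Proof.
pose A' := F - A; pose B' := G - B; rewrite -/A' -/B'.
have -> : F = A + A' by rewrite addrC subrK.
have -> : G = B + B' by rewrite addrC subrK.
move: A' B' => A' B'.
rewrite !(comp_lfunDl, comp_lfunDr, comp_lfunNl, comp_lfunNr).
rewrite -comp_lfunZl -comp_lfunZr scalerDr.
move: (A \o B)%VF (A \o B')%VF (A' \o B)%VF (A' \o B')%VF => ag fg ab fb.
move: (c *: _) (c *: _) => p q.
rewrite -(addrA ag) (addrC ag) addrK addrACA -opprD [RHS]addrAC.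
by congr (_ - _); rewrite addrA (addrC fg).
Qed.

Lemma op_derivM f g s X Y : op_deriv f s X -> op_deriv g s Y ->
  op_deriv (fun x => f x \o g x)%VF s ((X \o g s) + (f s \o Y))%VF.
Proof.
move=> fX gY; have [a a0 ha] := op_deriv_le fX; have [b b0 hb] := op_deriv_le gY.
case: fX gY => [C C0 hC] [D D0 hD].
exists (C * opn (g s) + opn (f s) * D + a * b).
  by rewrite !addr_ge0 ?mulr_ge0 ?opnorm_ge0.
move=> h h1; set F := f (s + h); set G := g (s + h).
rewrite comp_remainder.
rewrite !mulrDl; apply: le_trans (is_norm_triangle HE _ _) _; apply: lerD.
  apply: le_trans (is_norm_triangle HE _ _) _; apply: lerD.
    apply: le_trans (opnorm_comp HN _ _) _.
    by rewrite mulrAC ler_wpM2r ?opnorm_ge0 ?hC.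
  apply: le_trans (opnorm_comp HN _ _) _.
  by rewrite -mulrA ler_wpM2l ?opnorm_ge0 ?hD.
apply: le_trans (opnorm_comp HN _ _) _.
by rewrite -real_normK ?num_real// expr2 mulrACA ler_pM ?opnorm_ge0 ?ha ?hb.
Qed.

(** Termwise, [exp_coeff_taylor] bounds the remainder of the series by the
    series of exp (M |A|) shifted by two terms. *)
Lemma op_deriv_exp A s :
  op_deriv (fun x => op_exp dot (x%:C *: A)) s (A \o op_exp dot (s%:C *: A))%VF.
Proof.
pose M := `|s| + 1.
exists (opn A ^+ 2 * expR (M * opn A)).
  by rewrite mulr_ge0 ?sqr_ge0 ?expR_ge0.
move=> h h1; have hM : `|s| + `|h| <= M by rewrite lerD2l.
have M0 : 0 <= M by rewrite addr_ge0.
pose S x := exp_sum (x%:C *: A).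
have cS x N : op_cvg dot \oo (fun n => S x (n + N)%N) (op_exp dot (x%:C *: A)).
  exact: op_cvg_shift (op_exp_cvg _ _).
apply: (op_cvg_norm_le (F := \oo) (op_cvgB (op_cvgB (cS (s + h) 2%N) (cS s 2%N))
   (op_cvgZ h%:C (op_cvg_compl A (cS s 1%N))))).
apply: nearW => n.
have -> : S (s + h) (n + 2)%N - S s (n + 2)%N - h%:C *: (A \o S s (n + 1)%N)%VF =
   \sum_(k < n) (exp_coeff (s + h) k.+2 - exp_coeff s k.+2
      - h * exp_coeff s k.+1)%:C *: op_pow A k.+2.
  rewrite /S !exp_sumZ addn1 addn2.
  have -> : (A \o \sum_(k < n.+1) (exp_coeff s k)%:C *: op_pow A k)%VF =
      \sum_(k < n.+1) (exp_coeff s k)%:C *: op_pow A k.+1.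
    apply/lfunP => u; rewrite lfunE/= !sum_lfunE linear_sum; apply: eq_bigr => k _.
    by rewrite !scale_lfunE linearZ/= lfunE.
  rewrite 2!(big_ord_recl n.+1) /= opprD addrACA.
  rewrite {1 3}/exp_coeff/= !expr0 subrr add0r -sumrB scaler_sumr -sumrB.
  rewrite big_ord_recl /= [X in X + _](_ : _ = 0) ?add0r.
    apply: eq_bigr => k _; rewrite /bump/= !add1n.
    by rewrite scalerA -scalerBl -scalerBl -rmorphM -!rmorphB.
  rewrite scalerA -scalerBl -scalerBl -rmorphM -!rmorphB/=.
  rewrite /exp_coeff/= /bump/= !expr1 expr0 fact0 factS fact0 muln1 divr1.
  by rewrite !divr1 mulr1 [X in X - h]addrAC subrr add0r subrr scale0r.
apply: le_trans (norm_sum HE _ _ _) _.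
apply: (@le_trans _ _ (\sum_(k < n)
    h ^+ 2 * opn A ^+ 2 * exp_coeff (M * opn A) k)).
  apply: ler_sum => k _; rewrite opnZ.
  apply: (@le_trans _ _ (h ^+ 2 * exp_coeff M k * opn A ^+ k.+2)).
    by rewrite ler_pM// ?opnorm_ge0 ?exp_coeff_taylor ?op_pow_norm.
  rewrite /exp_coeff/= exprMn (exprD _ 2 k) le_eqVlt; apply/orP; left; apply/eqP.
  by ring.
rewrite -mulr_sumr [leRHS]mulrC [leRHS]mulrA.
apply: ler_wpM2l; first by rewrite mulr_ge0 ?sqr_ge0.
by apply: exp_coeff_sum_le; rewrite mulr_ge0 ?opnorm_ge0.
Qed.

End OperatorDerivative.

(** * Duhamel's inequality *)

Section Duhamel.
Context {R : realType} {V : vectType R[i]}.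
Variable dot : {dot V for (@conjc R)}.
Implicit Types (A B K X Y : 'End(V)) (f g : R -> 'End(V)) (s t h : R).
Local Notation opn := (opnorm (hnorm dot)).
Local Notation hn := (hnorm dot).
Local Notation exp := (op_exp dot).
Let HN := hnorm_is_norm dot.
Let HE := opnorm_is_norm HN.

Lemma op_exp_intertwine K A B :
  (K \o B = A \o K)%VF -> (K \o exp B = exp A \o K)%VF.
Proof.
move=> KBA; apply: (op_cvg_unique (F := \oo) (dot := dot)).
  exact: op_cvg_compl (op_exp_cvg dot B).
rewrite (_ : (fun n => _) = fun n => (exp_sum A n \o K)%VF).
  exact: op_cvg_compr (op_exp_cvg dot A).
apply/funext => n; apply/lfunP => u.
rewrite /exp_sum !lfunE/= !sum_lfunE linear_sum; apply: eq_bigr => k _.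
rewrite !scale_lfunE linearZ/=; congr (_ *: _).
suff : (K \o op_pow B k = op_pow A k \o K)%VF.
  by move=> /lfunP /(_ u); rewrite !lfunE.
elim: (nat_of_ord k) => [|j IH]; first by rewrite comp_lfun1l comp_lfun1r.
transitivity (K \o (B \o op_pow B j))%VF; first by [].
by rewrite comp_lfunA KBA -comp_lfunA IH comp_lfunA.
Qed.

Lemma op_expZ_intertwine K A B s : (K \o B = A \o K)%VF ->
  (K \o exp (s%:C *: B) = exp (s%:C *: A) \o K)%VF.
Proof.
move=> KBA; apply: op_exp_intertwine.
by rewrite -comp_lfunZr KBA comp_lfunZl.
Qed.

Lemma op_expZ_comm A s : (A \o exp (s%:C *: A) = exp (s%:C *: A) \o A)%VF.
Proof. exact: op_expZ_intertwine. Qed.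

(** The real mean value theorem, applied to the pairing of f u with the increment
    of f u itself. *)
Lemma op_mean_value f (f' : R -> 'End(V)) (a b c : R) u : a <= b ->
  (forall s, a <= s <= b -> op_deriv dot f s (f' s)) ->
  (forall s, a <= s <= b -> hn (f' s u) <= c) ->
  hn (f b u - f a u) <= (b - a) * c.
Proof.
move=> ab df hc; set w := f b u - f a u.
have dphi s : a <= s <= b ->
    is_derive s (1 : R) (fun x => rip dot (f x u) w) (rip dot (f' s u) w).
  by move=> /df; exact: op_deriv_rip.
have [||s sab] := MVT_segment (f := fun x => rip dot (f x u) w)
    (df := fun s => rip dot (f' s u) w) ab.
- move=> x; rewrite in_itv/= => /andP[ax xb]; apply: dphi.
  by rewrite !ltW.
- apply: derivable_within_continuous => x; rewrite in_itv/= => /dphi xd.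
  exact: ex_derive.
rewrite in_itv/= in sab; rewrite -ripBl -/w -hnorm_sqr => e.
have [->|w0] := eqVneq w 0.
  rewrite norm0// mulr_ge0 ?subr_ge0//.
  by apply: le_trans (hc _ sab); exact: norm_ge0.
have hw : 0 < hn w.
  by rewrite hnormE sqrtr_gt0 rip_gt0.
rewrite -(ler_pM2r hw) -expr2 e mulrC -mulrA ler_wpM2l ?subr_ge0//.
apply: le_trans (ler_norm _) _; apply: le_trans (rip_cauchy _ _ _) _.
by rewrite ler_wpM2r ?hc// ltW.
Qed.

Lemma op_deriv_sandwich A K B t s :
  op_deriv dot (fun x => exp ((t - x)%:C *: A) \o (K \o exp (x%:C *: B)))%VF s
    (exp ((t - s)%:C *: A) \o (((K \o B) - (A \o K)) \o exp (s%:C *: B)))%VF.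
Proof.
have h1 := op_deriv_reflect (op_deriv_exp dot A (t - s)).
have h2 := op_derivM (op_deriv_cst dot K s) (op_deriv_exp dot B s).
have := op_derivM h1 h2; congr (op_deriv _ _ _ _).
rewrite comp_lfun0l add0r op_expZ_comm comp_lfunNl addrC.
rewrite comp_lfunDl comp_lfunDr comp_lfunNl comp_lfunNr.
by rewrite !comp_lfunA.
Qed.

(** Duhamel: the two flows are compared along the interpolation
    exp ((t - s) A) K exp (s B), whose derivative contains only the defect
    K B - A K of intertwining. *)
Lemma duhamel A K B t c u : 0 <= t ->
  (forall s, 0 <= s <= t ->
    hn (exp ((t - s)%:C *: A) (((K \o B) - (A \o K))%VF (exp (s%:C *: B) u)))
      <= c) ->
  hn (exp (t%:C *: A) (K u) - K (exp (t%:C *: B) u)) <= t * c.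
Proof.
move=> t0 hc.
pose f x := (exp ((t - x)%:C *: A) \o (K \o exp (x%:C *: B)))%VF.
have f0 : f 0 u = exp (t%:C *: A) (K u).
  by rewrite /f subr0 scale0r op_exp0 2!comp_lfunE id_lfunE.
have ft : f t u = K (exp (t%:C *: B) u).
  by rewrite /f subrr scale0r op_exp0 2!comp_lfunE id_lfunE.
rewrite -f0 -ft (normB HN) -[t in t * c]subr0.
apply: (op_mean_value (f := f) t0 (fun s _ => op_deriv_sandwich A K B t s)) => s st.
by rewrite 2!comp_lfunE; exact: hc.
Qed.

(** On the interval from 0 to t, exp ((s + t - x) A) exp (x A) is constant. *)
Lemma op_exp_add A s t : 0 <= t ->
  (exp ((s + t)%:C *: A) = exp (s%:C *: A) \o exp (t%:C *: A))%VF.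
Proof.
move=> t0; apply/esym/lfunP => u; apply/eqP; rewrite -subr_eq0; apply/eqP.
apply: (is_norm_definite HN); apply/eqP; rewrite eq_le norm_ge0// andbT.
pose f x := (exp ((s + t - x)%:C *: A) \o (\1%VF \o exp (x%:C *: A)))%VF.
have f0 : f 0 u = exp ((s + t)%:C *: A) u.
  by rewrite /f subr0 scale0r op_exp0 2!comp_lfunE 2!id_lfunE.
have ft : f t u = (exp (s%:C *: A) \o exp (t%:C *: A))%VF u.
  by rewrite /f addrK 3!comp_lfunE id_lfunE.
rewrite -f0 -ft -[leRHS](mulr0 (t - 0)).
apply: (op_mean_value (f := f) t0
  (fun x _ => op_deriv_sandwich A \1%VF A (s + t) x)).
move=> x _; rewrite comp_lfun1l comp_lfun1r subrr comp_lfun0l comp_lfun0r.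
by rewrite zero_lfunE norm0.
Qed.

Lemma op_exp_eigen A z w s : 0 <= s -> A w = z *: w ->
  exp (s%:C *: A) w = exp (s%:C *: (z *: \1%VF)) w.
Proof.
move=> s0 Aw; apply/eqP; rewrite -subr_eq0; apply/eqP.
apply: (is_norm_definite HN); apply/eqP; rewrite eq_le norm_ge0// andbT.
rewrite -[w in exp _ w](id_lfunE w) -[X in _ - X](id_lfunE (exp _ w)).
rewrite -[leRHS](mulr0 s).
apply: duhamel => // x _; rewrite comp_lfun1l comp_lfun1r.
set E := exp (x%:C *: _).
have comm : (A \o E = E \o A)%VF.
  apply: op_expZ_intertwine.
  by rewrite -comp_lfunZl -comp_lfunZr comp_lfun1l comp_lfun1r.
have -> : (z *: \1%VF - A) (E w) = 0.
  rewrite add_lfunE opp_lfunE scale_lfunE id_lfunE.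
  move/lfunP: comm => /(_ w); rewrite !comp_lfunE => ->.
  by rewrite Aw linearZ/= subrr.
by rewrite linear0 norm0.
Qed.

Lemma op_exp_ker A w s : 0 <= s -> A w = 0 -> exp (s%:C *: A) w = w.
Proof.
move=> s0 Aw; rewrite (@op_exp_eigen _ 0)// ?scale0r//.
by rewrite scaler0 op_exp0 id_lfunE.
Qed.

End Duhamel.

(** * Adjoints *)

Section Adjoint.
Context {R : realType} {V : vectType R[i]}.
Variable dot : {dot V for (@conjc R)}.
Implicit Types (A B K X Y : 'End(V)).
Local Notation opn := (opnorm (hnorm dot)).
Local Notation hn := (hnorm dot).
Local Notation exp := (op_exp dot).
Let HN := hnorm_is_norm dot.
Let HE := opnorm_is_norm HN.

Lemma dotDl u v w : dot (u + v) w = dot u w + dot v w.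
Proof. exact: linearDl. Qed.

Lemma dotBl u v w : dot (u - v) w = dot u w - dot v w.
Proof. exact: linearBl. Qed.

Lemma dotBr u v w : dot w (u - v) = dot w u - dot w v.
Proof. exact: linearBr. Qed.

Lemma dot_suml (I : Type) (r : seq I) (F : I -> V) w :
  dot (\sum_(i <- r) F i) w = \sum_(i <- r) dot (F i) w.
Proof. exact: linear_sumlz. Qed.

Lemma dot_sumr (I : Type) (r : seq I) (F : I -> V) w :
  dot w (\sum_(i <- r) F i) = \sum_(i <- r) dot w (F i).
Proof. exact: linear_sumr. Qed.

Lemma dot_nondegenerate u v : (forall w, dot u w = dot v w) -> u = v.
Proof.
by move=> h; apply: (rip_inj (dot := dot)) => w; rewrite /rip h.
Qed.

Lemma is_adjoint_sym A B : is_adjoint dot A B -> is_adjoint dot B A.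
Proof. by move=> AB u v; rewrite (dotC dot v) -AB -dotC. Qed.

(** The map from u to the row of its pairings with a basis is injective, hence
    bijective by equality of dimensions; pulling back the pairings of u with
    the images of the basis gives the adjoint. *)
Lemma adjoint_exists A : exists B, is_adjoint dot A B.
Proof.
pose n := \dim {: V}; pose e := vbasis {: V}.
have lin w : linear (fun u : V => \row_(j < n) dot u (w j)).
  by move=> a u v; apply/rowP => j; rewrite !mxE dotDl dotZl.
pose Phi w : 'Hom(V, 'rV[R[i]]_n) := linfun (HB.pack_for {linear V -> 'rV[R[i]]_n}
  (fun u : V => \row_(j < n) dot u (w j))
  (GRing.isLinear.Build _ _ _ _ _ (lin w))).
have PhiE w u j : Phi w u 0 j = dot u (w j) by rewrite lfunE/= mxE.
pose phi := Phi (fun j : 'I_n => e`_j).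
have expand w : w = \sum_(i < n) coord e i w *: e`_i := coord_expand w.
have ext u v : (forall j : 'I_n, dot u e`_j = dot v e`_j) -> u = v.
  move=> h; apply: dot_nondegenerate => w; rewrite (expand w).
  by rewrite !dot_sumr; apply: eq_bigr => i _; rewrite !dotZr h.
have ker0 : lker phi == 0%VS.
  apply/lker0P => u v /rowP uv; apply: ext => j.
  by have := uv j; rewrite !PhiE.
have full : limg phi = fullv.
  apply/eqP; rewrite eqEdim subvf/= limg_dim_eq; last first.
    by rewrite (eqP ker0) capv0.
  by rewrite dimvf /dim/= mul1n.
pose B := ((phi^-1) \o Phi (fun j : 'I_n => A e`_j))%VF.
have BE u (j : 'I_n) : dot (B u) e`_j = dot u (A e`_j).
  transitivity (phi (B u) 0 j); first by rewrite PhiE.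
  by rewrite /B comp_lfunE limg_lfunVK ?PhiE// full memvf.
have Ae v : A v = \sum_(i < n) coord e i v *: A e`_i.
  by rewrite {1}(expand v) linear_sum; apply: eq_bigr => i _; rewrite linearZ.
exists B => u v; rewrite Ae dot_sumr {1}(expand v) dot_sumr.
by apply: eq_bigr => i _; rewrite (dotZr dot _ u) (dotZr dot _ (B u)) BE.
Qed.

Lemma adjointP A : is_adjoint dot A (adjoint dot A).
Proof. by have [B AB] := adjoint_exists A; exact: (xgetPex 0 (ex_intro _ B AB)). Qed.

(** |A u|^2 = <B A u, u> <= |B| |A u| |u|. *)
Lemma opn_adjoint_le A B : is_adjoint dot A B -> opn A <= opn B.
Proof.
move=> AB; apply: (opnorm_le HN) => [|u]; first exact: opnorm_ge0 HN _.
have [->|w0] := eqVneq (A u) 0.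
  by rewrite norm0// mulr_ge0 ?opnorm_ge0 ?norm_ge0.
have hw : 0 < hn (A u) by rewrite hnormE sqrtr_gt0 rip_gt0.
rewrite -(ler_pM2r hw) -expr2 hnorm_sqr /rip -AB -/(rip dot _ _).
apply: le_trans (ler_norm _) _; apply: le_trans (rip_cauchy _ _ _) _.
rewrite [leRHS]mulrAC ler_wpM2r ?norm_ge0//; exact: opnorm_bound.
Qed.

Lemma is_adjoint_cvg {T : Type} {F : set_system T} {FF : ProperFilter F}
    (f g : T -> 'End(V)) X Y :
  op_cvg dot F f X -> op_cvg dot F g Y ->
  (forall x, is_adjoint dot (f x) (g x)) -> is_adjoint dot X Y.
Proof.
move=> fX gY fg; have [Z XZ] := adjoint_exists X.
suff <- : Z = Y by [].
apply: (op_cvg_unique (F := F) (dot := dot) (f := g)) gY.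
apply: (op_cvg_le (b := fun x => opn (f x - X))); last exact: fX.
apply: nearW => x; apply: opn_adjoint_le => u v.
rewrite !lfunE/= !opp_lfunE dotBl dotBr.
by rewrite (is_adjoint_sym (fg x)) (is_adjoint_sym XZ).
Qed.

Lemma is_adjoint_exp A B : is_adjoint dot A B -> is_adjoint dot (exp A) (exp B).
Proof.
move=> AB.
apply: (is_adjoint_cvg (op_exp_cvg dot A) (op_exp_cvg dot B)) => n u v.
rewrite /exp_sum !sum_lfunE dot_suml dot_sumr; apply: eq_bigr => k _.
rewrite !scale_lfunE dotZl dotZr inv_natC conjc_real; congr (_ * _).
elim: (nat_of_ord k) v => [|j IH] v; first by rewrite !id_lfunE.
transitivity (dot (B (op_pow B j u)) v); first by rewrite -(comp_lfunE B).
by rewrite AB IH -(comp_lfunE (op_pow A j)) -op_powSr.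
Qed.

End Adjoint.

(** * Exponentials of scalar operators *)

Section ScalarExponential.
Context {R : realType} {V : vectType R[i]}.
Variable dot : {dot V for (@conjc R)}.
Local Notation hn := (hnorm dot).
Local Notation exp := (op_exp dot).
Let HN := hnorm_is_norm dot.
Let HE := opnorm_is_norm HN.

Lemma op_exp_real (x : R) : exp (x%:C *: \1%VF) = (expR x)%:C *: \1%VF :> 'End(V).
Proof.
apply: op_expE.
apply: (op_cvg_le
  (b := fun n => `|series (exp_coeff x) n - expR x| * opnorm hn \1%VF)).
  apply: nearW => n; rewrite exp_sumZ seriesEord/=.
  have -> : \sum_(k < n) (exp_coeff x k)%:C *: op_pow (\1%VF : 'End(V)) k =
      (\sum_(k < n) exp_coeff x k)%:C *: \1%VF.
    rewrite rmorph_sum scaler_suml; apply: eq_bigr => k _; congr (_ *: _).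
    by elim: (k : nat) => //= j ->; rewrite comp_lfun1l.
  by rewrite -scalerBl -rmorphB opnZ.
apply: cvg0Mr; apply/norm_cvg0P; apply/subr_cvg0.
exact: is_cvg_series_exp_coeff.
Qed.

(** The adjoint of exp (t z) is exp (t z^* ), and the product
    exp (t z^* ) exp (t z) exp (- 2 t Re z) has derivative 0. *)
Lemma hnorm_op_exp_scalar (z : R[i]) t u : 0 <= t ->
  hn (exp (t%:C *: (z *: \1%VF)) u) = expR (t * complex.Re z) * hn u.
Proof.
move=> t0; pose c := complex.Re z *+ 2.
pose E x (a : R[i]) : 'End(V) := exp (x%:C *: (a *: \1%VF)).
pose f x := (E x z^*%C \o (E x z \o E x (- c)%:C))%VF.
have adj x : is_adjoint dot (E x z) (E x z^*%C).
  apply: is_adjoint_exp => v w; rewrite !scale_lfunE !id_lfunE.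
  by rewrite !dotZl !dotZr conjc_real.
have df x : op_deriv dot f x 0.
  pose d a := op_deriv_exp dot (a *: \1%VF : 'End(V)) x.
  have := op_derivM (d z^*%C) (op_derivM (d z) (d (- c)%:C)).
  congr (op_deriv _ _ _ _); rewrite -/(E x _) -/(E x _) -/(E x _).
  move: (E x _) (E x _) (E x _) => X Y Z.
  apply/lfunP => v; rewrite zero_lfunE.
  do ?[rewrite ?(add_lfunE, comp_lfunE, scale_lfunE, id_lfunE, linearZ, linearD) /=].
  rewrite -!scalerDl; set k := (X in X *: _).
  suff -> : k = 0 by rewrite scale0r.
  rewrite /k /c; case: (z) => a b; apply/eqP; rewrite eq_complex/=.
  by apply/andP; split; apply/eqP; ring.
have ft : f t u = u.
  apply/eqP; rewrite -subr_eq0; apply/eqP.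
  apply: (is_norm_definite HN); apply/eqP; rewrite eq_le norm_ge0// andbT.
  have := op_mean_value t0 (fun x _ => df x) (u := u) (c := 0).
  rewrite mulr0 {2}/f /E !scale0r op_exp0 !comp_lfun1l id_lfunE; apply.
  by move=> x _; rewrite lfunE norm0.
have Ec : E t (- c)%:C u = (expR (t * - c))%:C *: u.
  by rewrite /E scalerA -rmorphM op_exp_real scale_lfunE id_lfunE.
have h : expR (t * - c) * hn (E t z u) ^+ 2 = hn u ^+ 2.
  transitivity (rip dot (f t u) u); last by rewrite ft hnorm_sqr.
  have -> : f t u = E t z^*%C (E t z ((expR (t * - c))%:C *: u)).
    rewrite -Ec.
    rewrite -(comp_lfunE (E t z)).
    rewrite -(comp_lfunE (E t z^*%C)).
    by [].
  transitivity (rip dot (E t z ((expR (t * - c))%:C *: u)) (E t z u)).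
    rewrite linearZ/= ripZl hnorm_sqr.
    by [].
  exact: (esym (congr1 (@complex.Re R) (adj t _ _))).
apply/eqP; rewrite -(eqrXn2 (n := 2)) ?mulr_ge0 ?(norm_ge0 HN) ?expR_ge0//.
rewrite exprMn -h mulrA -expRM_natl -expRD -/(E t z).
by rewrite (_ : _ + _ = 0) ?expR0 ?mul1r// /c; ring.
Qed.

End ScalarExponential.

(** * Spectral splitting of a bounded semigroup *)

Section SpectralSplitting.
Context {R : realType} {V : vectType R[i]}.
Variable dot : {dot V for (@conjc R)}.
Implicit Types (A K M W X Y : 'End(V)) (zs : seq R[i]) (p q : {poly R[i]}).
Local Notation opn := (opnorm (hnorm dot)).
Local Notation hn := (hnorm dot).
Local Notation exp := (op_exp dot).
Let HN := hnorm_is_norm dot.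
Let HE := opnorm_is_norm HN.

(** The value at A of the polynomial with roots zs. *)
Definition root_product A zs : 'End(V) :=
  foldr (fun z X => (X \o (A - z *: \1))%VF) \1%VF zs.

(** The value of p at A when size p <= n. The free bound n avoids computing the
    size of products. *)
Definition poly_op A n p : 'End(V) := \sum_(i < n) p`_i *: op_pow A i.

Lemma poly_op_widen A n p : (size p <= n)%N -> poly_op A n p = poly_op A (size p) p.
Proof.
move=> pn; rewrite /poly_op -(big_mkord xpredT (fun i => p`_i *: op_pow A i)).
rewrite (big_cat_nat (n := size p))//= [X in _ + X]big1_seq ?addr0 ?big_mkord//.
move=> i /andP[_]; rewrite mem_index_iota => /andP[/(nth_default 0) -> _].
by rewrite scale0r.
Qed.

Lemma poly_opM A n z q : (size q <= n)%N ->
  poly_op A n.+1 (('X - z%:P) * q) = (poly_op A n q \o (A - z *: \1))%VF.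
Proof.
move=> qn; rewrite /poly_op.
have -> : \sum_(i < n.+1) (('X - z%:P) * q)`_i *: op_pow A i =
  \sum_(i < n.+1) ('X * q)`_i *: op_pow A i - z *: \sum_(i < n.+1) q`_i *: op_pow A i.
  rewrite scaler_sumr -sumrB; apply: eq_bigr => i _.
  by rewrite scalerA -scalerBl mulrBl coefB coefCM.
rewrite big_ord_recl coefXM scale0r add0r [X in _ - z *: X]big_ord_recr.
rewrite [X in _ - z *: X]/= (nth_default 0 qn) scale0r addr0.
rewrite comp_lfunDr comp_lfunNr -comp_lfunZr comp_lfun1r; congr (_ - _).
apply/lfunP => u; rewrite comp_lfunE !sum_lfunE; apply: eq_bigr => i _.
by rewrite !scale_lfunE lift0 op_powSr coefXM comp_lfunE.
Qed.

Lemma poly_opZ A n a p : poly_op A n (a *: p) = a *: poly_op A n p.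
Proof.
by rewrite /poly_op scaler_sumr; apply: eq_bigr => i _; rewrite coefZ scalerA.
Qed.

(** The powers of A are linearly dependent; over an algebraically closed field
    the resulting polynomial splits. *)
Lemma annihilating_roots A : exists zs, root_product A zs = 0.
Proof.
pose m := \dim {: 'End(V)}.
pose X := [tuple op_pow A i | i < m.+1].
have nfree : ~~ free X.
  apply/negP => /eqP; rewrite size_tuple => h.
  have : (\dim <<X>> <= m)%N by rewrite dimvS// subvf.
  by rewrite h ltnn.
have [k [k0 [i ki]]] : exists k : 'I_m.+1 -> R[i],
    \sum_(i < m.+1) k i *: X`_i = 0 /\ exists i, k i != 0.
  apply: contrapT => h; move/negP: nfree; apply; apply/freeP => k k0 i.
  apply/eqP; apply: contrapT => ki; apply: h.
  by exists k; split=> //; exists i; exact/negP.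
pose p := \poly_(j < m.+1) k (inord j).
have pk (j : 'I_m.+1) : p`_j = k j by rewrite coef_poly ltn_ord inord_val.
have p0 : p != 0.
  by apply: contraNneq ki => p0; rewrite -pk p0 coef0.
have ev0 : poly_op A (size p) p = 0.
  rewrite -(@poly_op_widen _ m.+1) ?size_poly// /poly_op -[RHS]k0.
  by apply: eq_bigr => j _; rewrite pk (nth_map j) ?size_tuple//
    ?nth_ord_enum// -enumT size_enum_ord.
have [rs pE] := closed_field_poly_normal p.
exists rs.
have ev_prod (zs : seq R[i]) :
    poly_op A (size zs).+1 (\prod_(z <- zs) ('X - z%:P)) = root_product A zs.
  elim: zs => [|z zs IH].
    by rewrite big_nil /poly_op big_ord1 coefC scale1r.
  by rewrite big_cons /= poly_opM ?IH// size_prod_XsubC.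
move: ev0; rewrite -(@poly_op_widen _ (size rs).+1); last first.
  by rewrite {1}pE (leq_trans (size_scale_leq _ _))// size_prod_XsubC.
rewrite pE poly_opZ => /eqP; rewrite scaler_eq0 lead_coef_eq0 (negPf p0) /=.
by move=> /eqP h; rewrite -ev_prod.
Qed.

Lemma root_product_comm A zs : (A \o root_product A zs = root_product A zs \o A)%VF.
Proof.
elim: zs => [|z zs IH]; first by rewrite /= comp_lfun1l comp_lfun1r.
rewrite /= comp_lfunA IH -!comp_lfunA; congr (_ \o _)%VF.
rewrite comp_lfunDl comp_lfunDr comp_lfunNl comp_lfunNr.
by rewrite -comp_lfunZl -comp_lfunZr comp_lfun1l comp_lfun1r.
Qed.

(** Modulo A, a polynomial in A equals its constant term. *)
Lemma root_product_split A zs : exists M,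
  root_product A zs = (\prod_(z <- zs) - z) *: \1%VF + (A \o M)%VF.
Proof.
elim: zs => [|z zs [M IH]].
  by exists 0; rewrite big_nil scale1r comp_lfun0r addr0.
exists ((\prod_(z <- zs) - z) *: \1%VF + (M \o (A - z *: \1)))%VF.
rewrite big_cons /= IH comp_lfunDl -comp_lfunZl comp_lfun1l.
rewrite [(A \o (_ + _))%VF]comp_lfunDr -[(A \o (_ *: _))%VF]comp_lfunZr comp_lfun1r.
rewrite comp_lfunA addrA; congr (_ + _).
by rewrite scalerBr scalerA mulNr scaleNr addrC mulrC.
Qed.

(** Induction on the number of roots: if exp (s A) decays on W' = (A - z) W with
    rate d, comparing exp (s A) W with W exp (s z) by Duhamel's inequality
    leaves an error s C exp (- e s), where e = min (d, - Re z), and the factor s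
    is absorbed by halving the rate. *)
Lemma exp_eigen_decay A zs W : {in zs, forall z, complex.Re z < 0} ->
  (root_product A zs \o W = 0)%VF ->
  exists C d, [/\ 0 <= C, 0 < d &
    forall s, 0 <= s -> opn (exp (s%:C *: A) \o W)%VF <= C * expR (- d * s)].
Proof.
elim: zs W => [|z zs IH] W hz.
  rewrite /= comp_lfun1l => ->; exists 0, 1; split=> // s s0.
  by rewrite comp_lfun0r (norm0 HE) mul0r.
rewrite /= -comp_lfunA; set W' := ((_ - _) \o W)%VF => /IH[|C [d [C0 d0 hC]]].
  by move=> y yzs; apply: hz; rewrite inE yzs orbT.
have rez : complex.Re z < 0 by apply: hz; rewrite mem_head.
(* A rate common to both factors of the Duhamel integrand. *)
pose e := Num.min d (- complex.Re z).
have e0 : 0 < e by rewrite lt_min d0 oppr_gt0.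
have ed : e <= d by rewrite ge_min lexx.
have ez : complex.Re z <= - e by rewrite lerNr ge_min lexx orbT.
exists (opn W + C * (2 / e)), (e / 2); split.
- by rewrite addr_ge0 ?mulr_ge0 ?invr_ge0 ?(opnorm_ge0 HN)// ltW.
- by rewrite divr_gt0.
move=> s s0; apply: (opnorm_le HN) => [|u].
  by rewrite mulr_ge0 ?expR_ge0// addr_ge0 ?mulr_ge0 ?invr_ge0 ?(opnorm_ge0 HN)// ltW.
have := @duhamel _ _ dot A W (z *: \1%VF) s (C * expR (- e * s) * hn u) u s0.
set E := exp (s%:C *: (z *: \1%VF)).
have hd x : 0 <= x <= s -> hn (exp ((s - x)%:C *: A)
   (((W \o z *: \1) - (A \o W))%VF (exp (x%:C *: (z *: \1%VF)) u)))
    <= C * expR (- e * s) * hn u.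
  move=> /andP[x0 xs]; set y := exp (x%:C *: _) u.
  have -> : ((W \o z *: \1) - (A \o W))%VF = - W'.
    rewrite /W' comp_lfunDl comp_lfunNl -comp_lfunZl -comp_lfunZr.
    by rewrite comp_lfun1l comp_lfun1r opprB.
  have -> : hn (exp ((s - x)%:C *: A) ((- W') y)) =
      hn ((exp ((s - x)%:C *: A) \o W')%VF y).
    by rewrite comp_lfunE opp_lfunE linearN (normN HN).
  apply: le_trans (opnorm_bound HN _ _) _.
  have sx : 0 <= s - x by rewrite subr_ge0.
  apply: (@le_trans _ _ ((C * expR (- e * (s - x))) * (expR (x * - e) * hn u))).
    apply: ler_pM; rewrite ?(opnorm_ge0 HN) ?(norm_ge0 HN)//.
      apply: le_trans (hC _ sx) _; rewrite ler_wpM2l// ler_expR.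
      by rewrite ler_wpM2r// lerN2.
    by rewrite hnorm_op_exp_scalar// ler_wpM2r ?(norm_ge0 HN)// ler_expR ler_wpM2l.
  have -> : expR (- e * s) = expR (- e * (s - x)) * expR (x * - e).
    by rewrite -expRD; congr expR; ring.
  by rewrite le_eqVlt; apply/orP; left; apply/eqP; ring.
move=> /(_ hd) h.
have hE : hn (W (E u)) <= opn W * (expR (- e * s) * hn u).
  apply: le_trans (opnorm_bound HN _ _) _; rewrite ler_wpM2l ?(opnorm_ge0 HN)//.
  rewrite hnorm_op_exp_scalar// ler_wpM2r ?(norm_ge0 HN)// ler_expR.
  by rewrite mulrC ler_wpM2r.
rewrite comp_lfunE -[exp _ _](subrK (W (E u))).
apply: le_trans (is_norm_triangle HN _ _) _.
apply: le_trans (lerD h hE) _.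
have se : s <= 2 / e * expR (e / 2 * s).
  rewrite -ler_pdivrMl ?divr_gt0// invf_div.
  by apply: le_trans (expR_ge1Dx _); rewrite lerDr.
have ee : expR (- e * s) = expR (- (e / 2) * s) * expR (- (e / 2) * s).
  by rewrite -expRD; congr expR; field.
have e1 : expR (- (e / 2) * s) <= 1.
  by rewrite -expR0 ler_expR mulNr oppr_le0 mulr_ge0// divr_ge0// ltW.
have e2 : s * expR (- (e / 2) * s) <= 2 / e.
  by rewrite mulNr expRN ler_pdivrMr ?expR_gt0.
rewrite ee.
set a := expR _ in e1 e2 *; set n := hn u.
have a0 : 0 <= a by exact: expR_ge0.
have n0 : 0 <= n by exact: norm_ge0.
have w0 : 0 <= opn W by exact: opnorm_ge0.
rewrite [leLHS](_ : _ = C * ((s * a) * (a * n)) + opn W * (a * (a * n))); last first.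
  by ring.
rewrite [leRHS](_ : _ = C * (2 / e * (a * n)) + opn W * (a * n)); last by ring.
apply: lerD; rewrite ler_wpM2l//; first by rewrite ler_wpM2r// mulr_ge0.
by rewrite ler_piMl// mulr_ge0.
Qed.

(** Boundedness of the semigroup forbids Jordan blocks at the eigenvalue 0:
    along one, exp (s A) w would grow linearly. *)
Lemma bounded_ker_sqr A c w : (forall s, 0 <= s -> opn (exp (s%:C *: A)) <= c) ->
  A (A w) = 0 -> A w = 0.
Proof.
move=> hc AAw; apply/eqP; apply: contraT => /(rip_gt0 dot) yy.
set y := A w in AAw yy.
have c0 : 0 <= c by apply: le_trans (hc 0 _); rewrite ?(opnorm_ge0 HN).
pose D := (c + 1) * hn w * hn y.
have D0 : 0 <= D by rewrite !mulr_ge0 ?(norm_ge0 HN)// addr_ge0.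
have Dy : 0 < (D + 1) / rip dot y y by rewrite divr_gt0// ltr_wpDl.
(* The pairing with y grows linearly with slope <y, y>, while D bounds its
   increments: the time s makes the growth equal to D + 1. *)
set s := (D + 1) / rip dot y y in Dy.
have s0 := ltW Dy.
pose f x := rip dot (exp (x%:C *: A) w) y.
have df (x : R) : 0 <= x -> is_derive x (1 : R) f (rip dot y y).
  move=> x0; have := op_deriv_rip w y (op_deriv_exp dot A x).
  have -> // : (A \o exp (x%:C *: A))%VF w = y.
  by rewrite op_expZ_comm comp_lfunE; exact: op_exp_ker.
have [||x _] := MVT_segment (f := f) (df := fun=> rip dot y y) s0.
- by move=> x; rewrite in_itv/= => /andP[x0 _]; apply: df; exact: ltW.
- apply: derivable_within_continuous => x; rewrite in_itv/= => /andP[x0 _].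
  have xd := df x x0; exact: ex_derive.
rewrite subr0 /s mulrCA divff ?gt_eqF// mulr1 -/s => fs.
have : f s - f 0 <= D.
  rewrite /f -ripBl; apply: le_trans (ler_norm _) _.
  apply: le_trans (rip_cauchy _ _ _) _; rewrite ler_wpM2r ?(norm_ge0 HN)//.
  apply: le_trans (is_norm_triangle HN _ _) _; rewrite (normN HN) mulrDl mul1r.
  rewrite scale0r op_exp0 id_lfunE lerD2r.
  by apply: le_trans (opnorm_bound HN _ _) _; rewrite ler_wpM2r ?(norm_ge0 HN)// hc.
by rewrite fs gerDl ler10.
Qed.

(** Along an eigenvector the semigroup grows like exp (s Re z). *)
Lemma bounded_eigenvalue A c z w :
  (forall s, 0 <= s -> opn (exp (s%:C *: A)) <= c) ->
  A w = z *: w -> w != 0 -> complex.Re z <= 0.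
Proof.
move=> hc Aw w0; rewrite leNgt; apply/negP => z0.
have hw : 0 < hn w by rewrite hnormE sqrtr_gt0 rip_gt0.
have c0 : 0 <= c by apply: le_trans (hc 0 _); rewrite ?(opnorm_ge0 HN).
(* At this time 1 + s Re z exceeds c. *)
pose s := c / complex.Re z.
have s0 : 0 <= s by rewrite divr_ge0// ltW.
have : hn (exp (s%:C *: A) w) <= c * hn w.
  by apply: le_trans (opnorm_bound HN _ _) _; rewrite ler_wpM2r ?(norm_ge0 HN)// hc.
rewrite (op_exp_eigen _ s0 Aw) hnorm_op_exp_scalar// ler_pM2r// /s divfK ?gt_eqF//.
by move=> /(le_trans (expR_ge1Dx _)); rewrite gerDr ler10.
Qed.

(** Among the factors A - z of an annihilating product, those where z is not an
    eigenvalue are injective and can be cancelled, the powers of A collapse to A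
    by [bounded_ker_sqr], and the remaining roots have negative real part. If q
    is the product of X - z over the latter, then A q(A) = 0, and
    P = q(A) / q(0) is the projector: 1 - P lies in the range of A by
    [root_product_split], and it is annihilated by q(A), so that
    [exp_eigen_decay] applies to it. *)
Lemma spectral_splitting A c :
  (forall s, 0 <= s -> opn (exp (s%:C *: A)) <= c) ->
  (forall z, passmx.leigenvalue A z -> complex.Re z = 0 -> z = 0) ->
  exists P Q C d, [/\ (A \o P = 0)%VF, (P \o A = 0)%VF,
    (A \o Q = \1 - P)%VF & [/\ 0 <= C, 0 < d & forall s, 0 <= s ->
      opn (exp (s%:C *: A) - P) <= C * expR (- d * s)]].
Proof.
move=> hc spec.
have eig z y : (A - z *: \1%VF) y = 0 -> [\/ y = 0, z = 0 | complex.Re z < 0].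
  move=> yz; have [->|y0] := eqVneq y 0; first by constructor 1.
  have Ay : A y = z *: y.
    move: yz; rewrite add_lfunE opp_lfunE scale_lfunE id_lfunE.
    by move=> /eqP; rewrite subr_eq0 => /eqP.
  have [z0|/eqP z0] := eqVneq (complex.Re z) 0; last first.
    constructor 3; rewrite lt_neqAle (bounded_eigenvalue hc Ay y0) andbT.
    exact/eqP.
  constructor 2; apply: spec z0; apply/negP => /eqP ker0.
  by move: y0; rewrite -memv0 -ker0 memv_ker => /negP; apply; apply/eqP.
pose neg := [pred z : R[i] | complex.Re z < 0].
have filt zs w : root_product A zs w = 0 ->
    A (root_product A (seq.filter neg zs) w) = 0.
  elim: zs w => [|z zs IH] w.
    by rewrite /= id_lfunE => ->; rewrite linear0.
  rewrite /= comp_lfunE => /IH h.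
  case: ifP => [_|zneg]; first by rewrite /= comp_lfunE.
  set X := root_product A _ in h *.
  have H : (A - z *: \1%VF) (A (X w)) = 0.
    have XA : X (A w) = A (X w).
      move/lfunP: (root_product_comm A (seq.filter neg zs)) => /(_ w).
      by rewrite -/X !comp_lfunE.
    have e1 : X ((A - z *: \1%VF) w) = A (X w) - z *: X w.
      by rewrite add_lfunE opp_lfunE scale_lfunE id_lfunE linearB linearZ/= XA.
    transitivity (A (X ((A - z *: \1%VF) w))) => //.
    rewrite e1 add_lfunE opp_lfunE scale_lfunE id_lfunE linearB/=.
    by rewrite [X in _ = _ - X]linearZ.
  have [//|z0|] := eig _ _ H; last by rewrite zneg.
  by move: H; rewrite z0 scale0r subr0 => /(bounded_ker_sqr hc).
have [zs zs0] := annihilating_roots A; pose ns := seq.filter neg zs.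
have hns : {in ns, forall z, complex.Re z < 0}.
  by move=> z; rewrite mem_filter => /andP[].
pose q := root_product A ns.
have Aq : (A \o q = 0)%VF.
  apply/lfunP => w; rewrite comp_lfunE zero_lfunE; apply: filt.
  by rewrite zs0 zero_lfunE.
have [M qE] := root_product_split A ns; rewrite -/q in qE.
pose q0 := \prod_(z <- ns) - z; rewrite -/q0 in qE.
have q00 : q0 != 0.
  rewrite /q0 prodf_seq_neq0; apply/allP => z zns /=; rewrite oppr_eq0.
  by apply: contraTneq (hns z zns) => ->; rewrite ltxx.
pose P := q0^-1 *: q; pose Q := - (q0^-1 *: M).
have AQ : (A \o Q = \1 - P)%VF.
  rewrite /P /Q qE comp_lfunNr -comp_lfunZr scalerDr scalerA mulVf// scale1r.
  by rewrite opprD addrA subrr add0r.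
have AP : (A \o P = 0)%VF by rewrite /P -comp_lfunZr Aq scaler0.
have PA : (P \o A = 0)%VF.
  by rewrite /P -comp_lfunZl -root_product_comm -/q Aq scaler0.
have qP : (root_product A ns \o (\1 - P) = 0)%VF.
  by rewrite -AQ comp_lfunA -root_product_comm -/q Aq comp_lfun0l.
have [C [d [C0 d0 hC]]] := exp_eigen_decay hns qP.
exists P, Q, C, d; split=> //; split=> // s s0.
suff -> : exp (s%:C *: A) - P = (exp (s%:C *: A) \o (\1 - P))%VF by exact: hC.
rewrite comp_lfunDr comp_lfun1r comp_lfunNr; congr (_ - _).
apply/lfunP => w; rewrite comp_lfunE op_exp_ker//.
by rewrite -comp_lfunE AP zero_lfunE.
Qed.

End SpectralSplitting.

(** * Integrals over the half line *)

Section ImproperIntegral.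
Context {R : realType}.
Local Notation mu := (@lebesgue_measure R).
Local Notation halfline := (`[(0 : R), +oo[%classic).

Lemma ge0_integrable_FTC (f F : R -> R) (l : R) :
  (forall x, 0 <= x -> 0 <= f x) -> continuous f ->
  (forall x : R, is_derive x (1 : R) F (f x)) ->
  F x @[x --> +oo] --> l ->
  mu.-integrable halfline (EFin \o f) /\
  (\int[mu]_(x in halfline) f x)%R = l - F 0.
Proof.
move=> f0 cf dF Fl.
have cF : continuous F.
  move=> x; apply: differentiable_continuous; apply/derivable1_diffP.
  exact: ex_derive.
have e : (\int[mu]_(x in halfline) (f x)%:E = l%:E - (F 0)%:E)%E.
  apply: ge0_continuous_FTC2y => //.
  - exact: continuous_subspaceT.
  - by apply: cvg_at_right_filter; exact: cF.
  - by move=> x _; rewrite derive1E derive_val.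
split; last by rewrite /Rintegral e.
apply/integrableP; split.
  apply/measurable_EFinP; apply: measurable_funTS.
  exact: continuous_measurable_fun.
rewrite (_ : (\int[mu]_(x in halfline) _ = l%:E - (F 0)%:E)%E).
  by rewrite -EFinB ltry.
rewrite -e; apply: eq_integral => x; rewrite inE/= in_itv/= andbT => x0.
by rewrite /= ger0_norm ?f0.
Qed.

Lemma cvg_expR_decay (C d : R) : 0 < d ->
  C * expR (- d * s) @[s --> +oo] --> (0 : R).
Proof.
move=> d0; apply: cvg0Ml.
have h : (fun s : R => d * s) x @[x --> +oo] --> +oo.
  by apply: gt0_cvgMry => //; exact: cvg_id.
have := cvg_comp _ _ h (@cvgr_expR R).
by apply: cvg_trans; apply: near_eq_cvg; apply: nearW => s /=; rewrite mulNr.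
Qed.

Lemma is_derive_expR_decay (C d x : R) : d != 0 ->
  is_derive x (1 : R) (fun s => - (C / d) * expR (- d * s)) (C * expR (- d * x)).
Proof.
move=> d0.
have h : is_derive x (1 : R) (fun s => - d * s) (- d).
  apply: (@is_derive_quadratic _ _ _ _ 0) => h _.
  by rewrite mul0r (_ : _ - _ = 0) ?normr0//; ring.
have h2 := is_derive1_comp (is_derive_expR (- d * x)) h.
apply: (is_derive_eq (is_deriveZ (- (C / d)) h2)).
by rewrite /GRing.scale/=; field.
Qed.

(** An exponentially dominated function is f = (f + h) - h with h an
    exponential, so that the fundamental theorem for nonnegative functions
    applies to both terms. *)
Lemma decay_integrable_FTC (f F : R -> R) (l C d : R) : 0 < d ->
  (forall x, 0 <= x -> `|f x| <= C * expR (- d * x)) -> continuous f ->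
  (forall x : R, is_derive x (1 : R) F (f x)) ->
  F x @[x --> +oo] --> l ->
  mu.-integrable halfline (EFin \o f) /\
  (\int[mu]_(x in halfline) f x)%R = l - F 0.
Proof.
move=> d0 fC cf dF Fl; pose h x := C * expR (- d * x).
pose H s := - (C / d) * expR (- d * s).
have C0 : 0 <= C.
  by have := fC 0 (lexx _); rewrite mulr0 expR0 mulr1; apply: le_trans.
have dH x : is_derive x (1 : R) H (h x).
  by apply: is_derive_expR_decay; rewrite gt_eqF.
have ch : continuous h.
  move=> x; apply: cvgMl_tmp; apply: (@continuous_comp R R R (fun s => - d * s) expR).
    by apply: cvgMl_tmp; exact: cvg_id.
  exact: continuous_expR.
have H0 : H s @[s --> +oo] --> (0 : R) by exact: cvg_expR_decay.
have [ih eh] : mu.-integrable halfline (EFin \o h) /\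
    (\int[mu]_(x in halfline) h x)%R = 0 - H 0.
  by apply: ge0_integrable_FTC => // x _; rewrite mulr_ge0 ?expR_ge0.
have [ig eg] : mu.-integrable halfline (EFin \o (fun x => f x + h x)) /\
    (\int[mu]_(x in halfline) (f x + h x))%R = l + 0 - (F 0 + H 0).
  apply: (@ge0_integrable_FTC _ (fun x => F x + H x)).
  - move=> x x0; have := fC x x0; rewrite ler_norml -/(h x) => /andP[].
    by rewrite lerNl -subr_ge0 opprK addrC.
  - by move=> x; apply: cvgD; [exact: cf|exact: ch].
  - exact: cvgD.
have fE : f = (fun x => (f x + h x) - h x) by apply/funext => x; rewrite addrK.
have mD : measurable halfline by exact: measurable_itv.
split.
  rewrite (_ : EFin \o f =
    (fun x => (EFin \o (fun x => (f x + h x)%R)) x - (EFin \o h) x)%E).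
    exact: integrableB.
  by apply/funext => x; rewrite /= -EFinB addrK.
rewrite {1}fE RintegralB// eg eh; ring.
Qed.

End ImproperIntegral.

(** * The limit projector and the pseudo-inverse *)

Section PseudoInverse.
Context {R : realType} {V : vectType R[i]}.
Variable dot : {dot V for (@conjc R)}.
Implicit Types (A P Q S : 'End(V)).
Local Notation opn := (opnorm (hnorm dot)).
Local Notation hn := (hnorm dot).
Local Notation exp := (op_exp dot).
Let HN := hnorm_is_norm dot.
Let HE := opnorm_is_norm HN.

Lemma op_integral_eq (D : set R) (f : R -> 'End(V)) S :
  is_op_integral dot D f S -> op_integral dot D f = S.
Proof.
move=> fS; apply: xget_unique => // S' fS'.
apply/lfunP => u; apply: (dot_nondegenerate (dot := dot)) => v.
by have [_ _ ->] := fS u v; have [_ _ ->] := fS' u v.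
Qed.

Section Splitting.
Variables (A P Q : 'End(V)) (C d : R).
Hypothesis AP : (A \o P = 0)%VF.
Hypothesis AQ : (A \o Q = \1 - P)%VF.
Hypothesis d0 : 0 < d.
Hypothesis decay : forall s, 0 <= s ->
  opn (exp (s%:C *: A) - P) <= C * expR (- d * s).

Lemma op_exp_cvg_projector : op_cvg dot +oo (fun t : R => exp (t%:C *: A)) P.
Proof.
apply: op_cvg_le (cvg_expR_decay C d0); near=> t; apply: decay.
by near: t; exact: nbhs_pinfty_ge.
Unshelve. all: by end_near. Qed.

Lemma limit_projectorE : limit_projector dot A = P.
Proof. exact: op_limE op_exp_cvg_projector. Qed.

(** The integrand is the derivative of exp (s A) Q, which goes from Q to P Q. *)
Lemma is_op_integral_projector :
  is_op_integral dot `[(0 : R), +oo[%classic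
    (fun s : R => exp (s%:C *: A) - P) ((P \o Q)%VF - Q).
Proof.
have key (u v : V) :
    lebesgue_measure.-integrable `[(0 : R), +oo[%classic
      (EFin \o (fun s : R => rip dot ((exp (s%:C *: A) - P) u) v)) /\
    (\int[lebesgue_measure]_(s in `[(0 : R), +oo[%classic)
        rip dot ((exp (s%:C *: A) - P) u) v)%R = rip dot (((P \o Q)%VF - Q) u) v.
  have expP (s : R) : (exp (s%:C *: A) \o P)%VF = P.
    have := op_expZ_intertwine dot s (K := P) (A := A) (B := 0).
    by rewrite comp_lfun0r AP scaler0 op_exp0 comp_lfun1r => <-.
  have dF (x : R) : is_derive x (1 : R)
      (fun s => rip dot (exp (s%:C *: A) (Q u)) v)
      (rip dot ((exp (x%:C *: A) - P) u) v).
    have := op_deriv_rip (Q u) v (op_deriv_exp dot A x).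
    have -> : (A \o exp (x%:C *: A))%VF (Q u) = (exp (x%:C *: A) - P) u.
      rewrite op_expZ_comm -comp_lfunE -comp_lfunA AQ.
      by rewrite comp_lfunDr comp_lfunNr comp_lfun1r expP.
    by [].
  have df (x : R) : is_derive x (1 : R)
      (fun s => rip dot ((exp (s%:C *: A) - P) u) v)
      (rip dot ((A \o exp (x%:C *: A))%VF u) v - 0).
    have h := op_deriv_rip u v (op_deriv_exp dot A x).
    have h' := is_deriveB h (is_derive_cst (rip dot (P u) v) x (1 : R)).
    rewrite (_ : (fun s => _) =
      (fun s => rip dot (exp (s%:C *: A) u) v) - (fun=> rip dot (P u) v)) //.
    by apply/funext => s; rewrite add_lfunE opp_lfunE ripBl.
  have cf : continuous (fun s : R => rip dot ((exp (s%:C *: A) - P) u) v).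
    move=> x; apply: differentiable_continuous; apply/derivable1_diffP.
    have xd := df x; exact: ex_derive.
  have := @decay_integrable_FTC R _ (fun s => rip dot (exp (s%:C *: A) (Q u)) v)
    (rip dot (P (Q u)) v) (C * hn u * hn v) d d0 _ cf dF.
  rewrite scale0r op_exp0 id_lfunE -ripBl add_lfunE opp_lfunE comp_lfunE; apply.
    move=> x x0; apply: le_trans (rip_cauchy _ _ _) _.
    rewrite [leRHS]mulrAC ler_wpM2r ?(norm_ge0 HN)//.
    apply: le_trans (opnorm_bound HN _ _) _.
    by rewrite [leRHS]mulrAC ler_wpM2r ?(norm_ge0 HN)// decay.
  apply/subr_cvg0/norm_cvg0P.
  apply: (@squeeze_cvgr _ _ _ _ (fun=> 0)
     (fun s => opn (exp (s%:C *: A) - P) * (hn (Q u) * hn v))).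
  - apply: nearW => s; rewrite normr_ge0/= -ripBl mulrA.
    apply: le_trans (rip_cauchy _ _ _) _; rewrite ler_wpM2r ?(norm_ge0 HN)//.
    by rewrite -opp_lfunE -add_lfunE; exact: opnorm_bound.
  - exact: cvg_cst.
  - by apply: cvg0Mr; exact: op_exp_cvg_projector.
move=> u v re im.
have [i1 e1] := key u v; have [i2 e2] := key u ('i *: v).
have imE : im = fun s : R => rip dot ((exp (s%:C *: A) - P) u) ('i *: v).
  by apply/funext => s; rewrite /im dot_rip.
split => //; first by rewrite imE.
by rewrite dot_rip -e1 -e2 imE.
Qed.

Lemma pseudo_inverseE : pseudo_inverse dot A = Q - (P \o Q)%VF.
Proof.
rewrite /pseudo_inverse limit_projectorE (op_integral_eq is_op_integral_projector).
by rewrite opprB.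
Qed.

Lemma comp_pseudo_inverse : (A \o pseudo_inverse dot A = \1 - P)%VF.
Proof.
by rewrite pseudo_inverseE comp_lfunDr comp_lfunNr comp_lfunA AP comp_lfun0l subr0.
Qed.

End Splitting.
End PseudoInverse.

(** * Averaging *)

Section Averaging.
Context {R : realType} {V : vectType R[i]}.
Variable dot : {dot V for (@conjc R)}.
Variables L0 L1 L2 : 'End(V).
Local Notation opn := (opnorm (hnorm dot)).
Local Notation hn := (hnorm dot).
Local Notation exp := (op_exp dot).
Local Notation L := (generator L0 L1 L2).
Let HN := hnorm_is_norm dot.
Let HE := opnorm_is_norm HN.

Lemma opn_sub_le (X Y : 'End(V)) c : 0 <= c ->
  (forall u, hn (X u - Y u) <= c * hn u) -> opn (X - Y) <= c.
Proof.
by move=> c0 h; apply: (opnorm_le HN) => // u; rewrite add_lfunE opp_lfunE.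
Qed.

(** Either form of contractivity bounds the semigroups uniformly in the
    Hilbert norm, since all norms are equivalent and a Hilbert adjoint has the
    same operator norm. *)
Lemma uniform_bound (N : V -> R) : is_norm N ->
  ((forall g s : R, 0 < g -> 0 <= s -> opnorm N (exp (s%:C *: L g)) <= 1) \/
   (forall g s : R, 0 < g -> 0 <= s ->
      opnorm N (exp (s%:C *: adjoint dot (L g))) <= 1)) ->
  exists2 C, 0 <= C & forall g s : R, 0 < g -> 0 <= s ->
    opn (exp (s%:C *: L g)) <= C.
Proof.
move=> hN h; have [C C0 hC] := opnorm_equiv hN HN.
exists C => // g s g0 s0.
case: h => [/(_ g s g0 s0)|/(_ g s g0 s0)] h.
  by apply: le_trans (hC _) _; rewrite ler_piMr.
apply: (@le_trans _ _ (opn (exp (s%:C *: adjoint dot (L g))))).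
  apply: opn_adjoint_le; apply: is_adjoint_exp => u v.
  by rewrite !scale_lfunE dotZl dotZr adjointP conjc_real.
by apply: le_trans (hC _) _; rewrite ler_piMr.
Qed.

Variable C : R.
Hypothesis C0 : 0 <= C.
Hypothesis bound : forall g s : R, 0 < g -> 0 <= s ->
  opn (exp (s%:C *: L g)) <= C.

Lemma cvgV0 : (g^-1 : R) @[g --> +oo] --> (0 : R).
Proof. by apply/gtr0_cvgV0; [near=> g; near: g; exact: nbhs_pinfty_gt|exact: cvg_id].
Unshelve. all: by end_near. Qed.

Lemma cvg_poly_inv (a b : R) : a * g^-1 + b * (g^-1) ^+ 2 @[g --> +oo] --> (0 : R).
Proof.
apply: cvg0D; first by apply: cvg0Ml; exact: cvgV0.
apply: cvg0Ml.
rewrite (_ : (fun g => _) = (fun g : R => g^-1) \* (fun g : R => g^-1)).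
  by have := cvgM cvgV0 cvgV0; rewrite mulr0; exact.
by apply/funext => g; rewrite expr2.
Qed.

Lemma generator_rescale (g s : R) : g != 0 ->
  (s / g ^+ 2)%:C *: L g =
  s%:C *: (L2 + ((g^-1)%:C *: L1 + ((g^-1) ^+ 2)%:C *: L0)).
Proof.
move=> g0; apply/lfunP => u; apply: (rip_inj (dot := dot)) => w.
rewrite /generator !(scale_lfunE, add_lfunE) !(ripZl, ripDl).
by field.
Qed.

(** On the fast time scale 1 / g ^ 2 only the leading generator is seen. *)
Lemma rescaled_exp_cvg (s : R) : 0 <= s ->
  op_cvg dot +oo (fun g => exp ((s / g ^+ 2)%:C *: L g)) (exp (s%:C *: L2)).
Proof.
move=> s0; pose E := expR (s * opn L2).
apply: (op_cvg_le (b := fun g => s * C * opn L1 * E * g^-1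
   + s * C * opn L0 * E * (g^-1) ^+ 2)); last exact: cvg_poly_inv.
near=> g; have g0 : 0 < g by near: g; exact: nbhs_pinfty_gt.
have ig0 : 0 <= g^-1 by rewrite invr_ge0 ltW.
set D := (g^-1)%:C *: L1 + ((g^-1) ^+ 2)%:C *: L0.
have hD : opn D <= g^-1 * opn L1 + (g^-1) ^+ 2 * opn L0.
  apply: le_trans (is_norm_triangle HE _ _) _.
  by rewrite !opnZ !ger0_norm ?exprn_ge0.
have E0 : 0 <= E := expR_ge0 _.
rewrite generator_rescale ?gt_eqF// -/D; apply: opn_sub_le => [|u].
  by rewrite addr_ge0// !mulr_ge0 ?(opnorm_ge0 HN) ?exprn_ge0.
have hd x : 0 <= x <= s -> hn (exp ((s - x)%:C *: (L2 + D))
    (((\1 \o L2) - ((L2 + D) \o \1))%VF (exp (x%:C *: L2) u)))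
    <= C * ((g^-1 * opn L1 + (g^-1) ^+ 2 * opn L0) * (E * hn u)).
  move=> /andP[x0 xs].
  have -> : ((\1 \o L2) - ((L2 + D) \o \1))%VF = - D.
    by rewrite comp_lfun1l comp_lfun1r [- (L2 + D)]opprD [LHS]addrA subrr add0r.
  apply: le_trans (opnorm_bound HN _ _) _.
  apply: ler_pM; rewrite ?(opnorm_ge0 HN) ?(norm_ge0 HN)//.
    rewrite -generator_rescale ?gt_eqF//; apply: bound => //.
    by rewrite divr_ge0 ?exprn_ge0 ?subr_ge0// ltW.
  rewrite opp_lfunE (normN HN); apply: le_trans (opnorm_bound HN _ _) _.
  apply: ler_pM; rewrite ?(opnorm_ge0 HN) ?(norm_ge0 HN)//.
  apply: le_trans (opnorm_bound HN _ _) _; rewrite ler_wpM2r ?(norm_ge0 HN)//.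
  apply: le_trans (op_exp_norm _ _) _; rewrite ler_expR opnZ ger0_norm//.
  by rewrite ler_wpM2r ?(opnorm_ge0 HN).
have := duhamel s0 hd; rewrite !id_lfunE => /le_trans; apply.
by rewrite le_eqVlt; apply/orP; left; apply/eqP; ring.
Unshelve. all: by end_near. Qed.

Lemma leading_exp_bound (s : R) : 0 <= s -> opn (exp (s%:C *: L2)) <= C.
Proof.
move=> s0; apply: (op_cvg_norm_le (rescaled_exp_cvg s0)); near=> g.
have g0 : 0 < g by near: g; exact: nbhs_pinfty_gt.
by apply: bound => //; rewrite divr_ge0 ?exprn_ge0// ltW.
Unshelve. all: by end_near. Qed.

Variables P Q : 'End(V).
Hypothesis L2P : (L2 \o P = 0)%VF.
Hypothesis PL2 : (P \o L2 = 0)%VF.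
Hypothesis L2Q : (L2 \o Q = \1 - P)%VF.
Hypothesis cvgP : op_cvg dot +oo (fun s : R => exp (s%:C *: L2)) P.
Hypothesis PL1P : (P \o (L1 \o P) = 0)%VF.

Let PP : (P \o P = P)%VF.
Proof.
have : (P \o (L2 \o Q) = 0)%VF by rewrite comp_lfunA PL2 comp_lfun0l.
rewrite L2Q comp_lfunDr comp_lfunNr comp_lfun1r => /eqP.
by rewrite subr_eq0 => /eqP <-.
Qed.

(** On the kernel of P the fast flow contracts to 0 before time t, and by
    uniform boundedness the remaining evolution cannot undo that. *)
Lemma fast_part_cvg (t : R) : 0 < t ->
  op_cvg dot +oo (fun g => exp (t%:C *: L g) \o (\1 - P))%VF 0.
Proof.
move=> t0; apply/cvgrPdist_le => /= eps eps0.
have c1 : 0 < C * 2 + 1 by rewrite ltr_wpDl// mulr_ge0.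
have d0 : 0 < eps / (C * 2 + 1) by rewrite divr_gt0.
set d := eps / _ in d0.
have PE (s : R) : (exp (s%:C *: L2) \o P)%VF = P.
  have := op_expZ_intertwine dot s (K := P) (A := L2) (B := 0).
  by rewrite comp_lfun0r L2P scaler0 op_exp0 comp_lfun1r => <-.
have [s [s0 hs]] : exists s : R, 0 <= s /\ opn (exp (s%:C *: L2) - P) <= d.
  have /cvgrPdist_le /(_ _ d0) h := cvgP.
  near +oo_R => s; exists s; split; first by near: s; exact: nbhs_pinfty_ge.
  have : `|0 - opn (exp (s%:C *: L2) - P)| <= d by near: s.
  by rewrite sub0r normrN ger0_norm ?(opnorm_ge0 HN).
have d1 : 0 < d / (opn (\1%VF - P) + 1).
  by rewrite divr_gt0// ltr_wpDl ?(opnorm_ge0 HN).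
near=> g.
have g0 : 0 < g by near: g; exact: nbhs_pinfty_gt.
have sg0 : 0 <= s / g ^+ 2 by rewrite divr_ge0 ?exprn_ge0// ltW.
have sgt : s / g ^+ 2 <= t.
  have g1 : 1 <= g by near: g; exact: nbhs_pinfty_ge.
  have gs : s / t <= g by near: g; apply: nbhs_pinfty_ge; exact: num_real.
  rewrite ler_pdivrMr ?exprn_gt0// mulrC -ler_pdivrMr//.
  by apply: le_trans gs _; rewrite expr2; apply: ler_peMr => //; exact: ltW.
have hg : opn (exp ((s / g ^+ 2)%:C *: L g) - exp (s%:C *: L2))
    <= d / (opn (\1%VF - P) + 1).
  have : `|0 - opn (exp ((s / g ^+ 2)%:C *: L g) - exp (s%:C *: L2))|
      <= d / (opn (\1%VF - P) + 1).
    by near: g; have /cvgrPdist_le := rescaled_exp_cvg s0; apply.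
  by rewrite sub0r normrN ger0_norm ?(opnorm_ge0 HN).
rewrite subr0 sub0r normrN ger0_norm ?(opnorm_ge0 HN)//.
rewrite -[t in t%:C](subrK (s / g ^+ 2)) op_exp_add// -comp_lfunA.
apply: le_trans (opnorm_comp HN _ _) _.
apply: (@le_trans _ _ (C * (d + d))); last first.
  have -> : eps = C * (d + d) + d.
    rewrite [RHS](_ : _ = (C * 2 + 1) * d); last by ring.
    by rewrite /d mulrC divfK// gt_eqF.
  by rewrite lerDl ltW.
apply: ler_pM; rewrite ?(opnorm_ge0 HN)//.
  by apply: bound => //; rewrite subr_ge0.
rewrite -[exp ((s / g ^+ 2)%:C *: L g)](subrK (exp (s%:C *: L2))) comp_lfunDl.
apply: le_trans (is_norm_triangle HE _ _) _; apply: lerD.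
  apply: le_trans (opnorm_comp HN _ _) _.
  apply: le_trans (ler_wpM2r (opnorm_ge0 HN _) hg) _.
  rewrite mulrAC ler_pdivrMr; last by rewrite ltr_wpDl ?(opnorm_ge0 HN).
  by rewrite ler_wpM2l ?lerDl// ltW.
by rewrite comp_lfunDr comp_lfunNr comp_lfun1r PE.
Unshelve. all: by end_near. Qed.

Let Linf := (P \o (L0 \o P))%VF - (P \o (L1 \o (Q \o (L1 \o P))))%VF.

Let PLinf : (P \o Linf = Linf)%VF.
Proof. by rewrite comp_lfunDr comp_lfunNr !(comp_lfunA P P) PP. Qed.

Let LinfP : (Linf \o P = Linf)%VF.
Proof. by rewrite comp_lfunDl comp_lfunNl -!comp_lfunA PP. Qed.

(* First and second order terms of the expansion of the slow subspace. They
   solve L2 G = - L1 P and L2 H = Linf - L0 P - L1 G. *)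
Let G := (- (Q \o (L1 \o P)))%VF.
Let H := (- (Q \o ((L0 \o P) + (L1 \o G))))%VF.
Let corrector (g : R) := (g^-1)%:C *: G + ((g^-1) ^+ 2)%:C *: H.
Let R1 := ((L0 \o G) + (L1 \o H) - (G \o Linf))%VF.
Let R2 := ((L0 \o H) - (H \o Linf))%VF.

(** The two correctors are chosen to cancel the terms of order g and to
    project the terms of order 1 onto the range of P. *)
Lemma corrector_intertwines (g : R) : g != 0 ->
  ((L g \o (P + corrector g)) - ((P + corrector g) \o Linf))%VF =
  (g^-1)%:C *: R1 + ((g^-1) ^+ 2)%:C *: R2.
Proof.
move=> g0; apply/lfunP => u.
have zP : L2 (P u) = 0 by have /lfunP/(_ u) := L2P; rewrite comp_lfunE zero_lfunE.
have PL1 : P (L1 (P u)) = 0.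
  by have /lfunP/(_ u) := PL1P; rewrite 2!comp_lfunE zero_lfunE.
have LQ v : L2 (Q v) = v - P v.
  by have /lfunP/(_ v) := L2Q; rewrite comp_lfunE add_lfunE opp_lfunE id_lfunE.
have LG : L2 (G u) = - L1 (P u).
  by rewrite /G opp_lfunE linearN/= 2!comp_lfunE LQ PL1 subr0.
have LinfE : Linf u = P (L0 (P u)) + P (L1 (G u)).
  rewrite /Linf add_lfunE opp_lfunE 6!comp_lfunE /G opp_lfunE 2!comp_lfunE.
  by rewrite linearN/= linearN.
have LH : L2 (H u) = Linf u - L0 (P u) - L1 (G u).
  rewrite /H opp_lfunE linearN/= comp_lfunE LQ add_lfunE 2!comp_lfunE LinfE.
  by rewrite opprB linearD/= [- (_ + _)]opprD addrA.
have Pl : P (Linf u) = Linf u by have /lfunP/(_ u) := PLinf; rewrite comp_lfunE.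
(* Pairing with w turns the vector identity into a real field identity. *)
apply: (rip_inj (dot := dot)) => w.
rewrite /corrector /R1 /R2 /generator; move: LG LH Pl.
move: (G) (H) (Linf) => G' H' Linf' LG LH Pl.
do ?[rewrite ?(add_lfunE, opp_lfunE, scale_lfunE, comp_lfunE)].
rewrite !(linearD, linearZ)/= zP LG LH Pl.
rewrite !(ripDl, ripNl, ripZl, rip0).
by field.
Qed.

(** The corrector is of order 1 / g, so K(g) may be replaced by P on both sides
    of Duhamel's inequality. *)
Lemma slow_part_cvg (t : R) : 0 <= t ->
  op_cvg dot +oo (fun g => exp (t%:C *: L g) \o P)%VF
    (P \o (exp (t%:C *: Linf) \o P))%VF.
Proof.
move=> t0; pose E := expR (t * opn Linf).
have E0 : 0 <= E := expR_ge0 _.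
have -> : (P \o (exp (t%:C *: Linf) \o P) = P \o exp (t%:C *: Linf))%VF.
  have comm : (P \o Linf = Linf \o P)%VF by rewrite PLinf LinfP.
  by rewrite -(op_expZ_intertwine dot t comm) comp_lfunA PP.
apply: (op_cvg_le (b := fun g =>
   (t * C * opn R1 * E + (C + E) * opn G) * g^-1
   + (t * C * opn R2 * E + (C + E) * opn H) * (g^-1) ^+ 2)); last exact: cvg_poly_inv.
near=> g; have g0 : 0 < g by near: g; exact: nbhs_pinfty_gt.
have ig0 : 0 <= g^-1 by rewrite invr_ge0 ltW.
have hc : opn (corrector g) <= g^-1 * opn G + (g^-1) ^+ 2 * opn H.
  apply: le_trans (is_norm_triangle HE _ _) _.
  by rewrite !opnZ !ger0_norm ?exprn_ge0.
have hR : opn ((g^-1)%:C *: R1 + ((g^-1) ^+ 2)%:C *: R2) <=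
    g^-1 * opn R1 + (g^-1) ^+ 2 * opn R2.
  apply: le_trans (is_norm_triangle HE _ _) _.
  by rewrite !opnZ !ger0_norm ?exprn_ge0.
have expE (x : R) : 0 <= x <= t -> opn (exp (x%:C *: Linf)) <= E.
  move=> /andP[x0 xt]; apply: le_trans (op_exp_norm _ _) _.
  by rewrite ler_expR opnZ ger0_norm// ler_wpM2r ?(opnorm_ge0 HN).
set K := P + corrector g.
have hK : opn ((exp (t%:C *: L g) \o K) - (K \o exp (t%:C *: Linf)))%VF <=
    t * (C * ((g^-1 * opn R1 + (g^-1) ^+ 2 * opn R2) * E)).
  apply: opn_sub_le => [|u].
    by rewrite !mulr_ge0// addr_ge0// mulr_ge0 ?(opnorm_ge0 HN) ?exprn_ge0.
  rewrite 2!comp_lfunE -mulrA; apply: duhamel => // x xt.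
  have /andP[x0 xt'] := xt.
  have -> : ((K \o Linf) - (L g \o K))%VF =
      - ((g^-1)%:C *: R1 + ((g^-1) ^+ 2)%:C *: R2).
    by rewrite -corrector_intertwines ?gt_eqF// opprB.
  apply: le_trans (opnorm_bound HN _ _) _; rewrite -mulrA.
  apply: ler_pM; rewrite ?(opnorm_ge0 HN) ?(norm_ge0 HN)//.
    by apply: bound; rewrite ?subr_ge0.
  rewrite opp_lfunE (normN HN); apply: le_trans (opnorm_bound HN _ _) _.
  rewrite -mulrA; apply: ler_pM; rewrite ?(opnorm_ge0 HN) ?(norm_ge0 HN)//.
  apply: le_trans (opnorm_bound HN _ _) _.
  by rewrite ler_wpM2r ?(norm_ge0 HN)// expE.
have -> : ((exp (t%:C *: L g) \o P) - (P \o exp (t%:C *: Linf)))%VF =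
   ((exp (t%:C *: L g) \o K) - (K \o exp (t%:C *: Linf)))%VF
   + (- (exp (t%:C *: L g) \o corrector g)
       + (corrector g \o exp (t%:C *: Linf)))%VF.
  rewrite /K comp_lfunDl comp_lfunDr opprD addrACA -addrA.
  move: (exp _ \o P)%VF (P \o exp _)%VF (exp _ \o corrector g)%VF => a b c.
  move: (corrector g \o _)%VF => d.
  by rewrite addrA addrK subrK.
apply: le_trans (is_norm_triangle HE _ _) _.
apply: (@le_trans _ _ (t * (C * ((g^-1 * opn R1 + (g^-1) ^+ 2 * opn R2) * E))
   + (C * (g^-1 * opn G + (g^-1) ^+ 2 * opn H)
      + (g^-1 * opn G + (g^-1) ^+ 2 * opn H) * E))); last first.
  by rewrite le_eqVlt; apply/orP; left; apply/eqP; ring.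
apply: lerD => //; apply: le_trans (is_norm_triangle HE _ _) _.
rewrite (normN HE); apply: lerD; apply: le_trans (opnorm_comp HN _ _) _.
  by apply: ler_pM; rewrite ?(opnorm_ge0 HN) ?bound.
by apply: ler_pM; rewrite ?(opnorm_ge0 HN)// expE// t0 lexx.
Unshelve. all: by end_near. Qed.

Lemma averaging (t : R) : 0 < t ->
  op_cvg dot +oo (fun g => exp (t%:C *: L g)) (P \o (exp (t%:C *: Linf) \o P))%VF.
Proof.
move=> t0.
have -> : (fun g => exp (t%:C *: L g)) =
    (fun g => (exp (t%:C *: L g) \o P)%VF + (exp (t%:C *: L g) \o (\1 - P))%VF).
  by apply/funext => g; rewrite -comp_lfunDr addrC subrK comp_lfun1r.
have := op_cvgD (slow_part_cvg (ltW t0)) (fast_part_cvg t0).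
rewrite addr0; exact.
Qed.

End Averaging.

Theorem theorem3p1 (R : realType) (V : vectType R[i])
    (dot : {dot V for (@conjc R)}) (L0 L1 L2 : 'End(V))
    (spectral : forall z : R[i],
       passmx.leigenvalue L2 z -> complex.Re z = 0 -> z = 0)
    (contractivity : exists N : V -> R, is_norm N /\
       ((forall g s : R, 0 < g -> 0 <= s ->
           opnorm N (op_exp dot (s%:C *: generator L0 L1 L2 g)) <= 1) \/
        (forall g s : R, 0 < g -> 0 <= s ->
           opnorm N (op_exp dot (s%:C *: adjoint dot (generator L0 L1 L2 g)))
             <= 1)))
    (centering : (limit_projector dot L2 \o (L1 \o limit_projector dot L2))%VF
                   = 0)
    (t : R) (ht : 0 < t) :
  op_cvg dot +oo (fun g : R => op_exp dot (t%:C *: generator L0 L1 L2 g))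
    (limit_projector dot L2 \o
       (op_exp dot (t%:C *: effective_generator dot L0 L1 L2) \o
          limit_projector dot L2))%VF.
Proof.
have [N [hN /(uniform_bound hN)[C C0 bound]]] := contractivity.
have [P [Q [D [d [L2P PL2 L2Q [D0 d0 decay]]]]]] :=
  spectral_splitting (leading_exp_bound C0 bound) spectral.
have PE := limit_projectorE d0 decay.
have := @averaging R V dot L0 L1 L2 C C0 bound P (pseudo_inverse dot L2) L2P PL2.
rewrite /effective_generator PE; apply=> //.
- exact: comp_pseudo_inverse L2P L2Q d0 decay.
- exact: op_exp_cvg_projector d0 decay.
- by rewrite -PE.
Qed.
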